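(* For positive integers $m$ and $n$, the expressions $$(-1)^m(n+1)!\sum_{k=0}^n\frac{1}{k!}\binom{m+k+1}{m}J_{k-m-1}(x)\left(\frac{x}{2}\right)^{k+m}$$ and $$(-1)^m(n+1)!\sum_{k=0}^n\frac{1}{k!}\binom{m+k+1}{m}Y_{k-m-1}(x)\left(\frac{x}{2}\right)^{k+m}$$ are both symmetric with respect to $m$ and $n$; that is, for all positive integers $m,n$, all $x\in\mathbb{C}\setminus(-\infty,0]$, and for $B=J$ as well as for $B=Y$, $$(-1)^m(n+1)!\sum_{k=0}^n\frac{1}{k!}\binom{m+k+1}{m}B_{k-m-1}(x)\left(\frac{x}{2}\right)^{k+m}=(-1)^n(m+1)!\sum_{k=0}^m\frac{1}{k!}\binom{n+k+1}{n}B_{k-n-1}(x)\left(\frac{x}{2}\right)^{k+n}.$$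
   Context: $J_\nu$ and $Y_\nu$ denote the Bessel functions of the first and second kind of order $\nu$, with their principal branches on $\mathbb{C}\setminus(-\infty,0]$. *)

(* Defs.v *)
From Stdlib Require Import Reals Factorial.
From Coquelicot Require Import Coquelicot.

Open Scope C_scope.

(* Like [RInt] or [Series], the two operators below are total and carry the
   usual meaning whenever the limit, resp. the sum, exists. *)
Definition Clim_seq (u : nat -> C) : C :=
  iota (T := C_CompleteNormedModule) (fun l : C => filterlim u eventually (locally l)).

Definition Cseries (a : nat -> C) : C :=
  iota (T := C_CompleteNormedModule) (fun l : C => is_series a l).

Definition Cexp (z : C) : C :=
  (exp (Re z) * cos (Im z), exp (Re z) * sin (Im z))%R.

Definition Ccos (z : C) : C := (Cexp (Ci * z) + Cexp (- (Ci * z))) / 2.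

Definition Csin (z : C) : C := (Cexp (Ci * z) - Cexp (- (Ci * z))) / (2 * Ci).

(* Principal argument, with values in (-PI, PI] for z <> 0. *)
Definition Arg (z : C) : R :=
  if Rle_dec 0 (Im z) then acos (Re z / Cmod z) else (- acos (Re z / Cmod z))%R.

Definition Clog (z : C) : C := (ln (Cmod z), Arg z).

(* Principal branch of z^a, for z <> 0; [z ^ k] is the power with k : nat. *)
Definition Cpower (z a : C) : C := Cexp (a * Clog z).

Definition slit_plane (z : C) : Prop := ~ (Im z = 0%R /\ (Re z <= 0)%R).

(* z (z+1) ... (z+n-1) *)
Fixpoint Cpochhammer (z : C) (n : nat) : C :=
  match n with
  | O => 1
  | S p => Cpochhammer z p * (z + INR p)
  end.

(* The entire function 1/Gamma, through Euler's limit
   Gamma(z) = lim n! n^z / (z (z+1) ... (z+n)); it vanishes at 0, -1, -2, ... *)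
Definition Crgamma (z : C) : C :=
  Clim_seq (fun n =>
    Cpochhammer z (S n) / (INR (fact n) * Cpower (INR n) z)).

(* (z/2)^nu sum_k (-1)^k (z/2)^(2k) / (k! Gamma(nu+k+1)) *)
Definition besselJ (nu z : C) : C :=
  Cpower (z / 2) nu *
  Cseries (fun k =>
    (-1) ^ k * Crgamma (nu + INR k + 1) / INR (fact k) * (z / 2) ^ (2 * k)).

Definition besselY_quotient (nu z : C) : C :=
  (besselJ nu z * Ccos (nu * PI) - besselJ (- nu) z) / Csin (nu * PI).

(* At integer orders, i.e. at the zeros of sin (nu * PI), the quotient is
   replaced by its limiting value as the order tends to nu. *)
Definition besselY (nu z : C) : C :=
  if Ceq_dec (Csin (nu * PI)) 0
  then C_lim (fun mu => besselY_quotient mu z) nu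
  else besselY_quotient nu z.

(* [sum_n a n] has the n+1 terms a 0, ..., a n; [Binomial.C a b] is the
   binomial coefficient "a choose b" as a real number. *)
Definition bessel_expr (B : C -> C -> C) (m n : nat) (x : C) : C :=
  (-1) ^ m * INR (fact (n + 1)) *
  sum_n (fun k : nat =>
    / INR (fact k) * Binomial.C (m + k + 1) m
    * B (INR k - INR m - 1) x * (x / 2) ^ (k + m)) n.

(* Main.v *)
Require Import Defs.
From Stdlib Require Import Reals ZArith Factorial Lra Lia ClassicalEpsilon.
From Coquelicot Require Import Coquelicot.

(** Both families obey the three-term recurrence
    (x/2) (B_{j-1}(x) + B_{j+1}(x)) = j B_j(x) at all integers j, and this alone
    forces the symmetry.

    The algebra.  Divide the expression by (m+1)! (n+1)!.  The result T(m,n) is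
    a sum over k <= n of terms weighted by
    w(m,k) = (m+k+1)! / (m! k! (m+1)! (k+1)!), which is symmetric in m and k.
    Increasing n adds one term to T.  Increasing m also changes T by a single
    term: this is [half_sum_column], proved by induction on n from the recurrence
    and the identity w(m+1,n) - w(m,n+1) = (n-m) w(m+1,n+1).  The recurrence at
    j = 0 gives B_{-1} = -B_1, hence B_{-j} = (-1)^j B_j at all integers, and with
    this reflection the increment of T(m,n) in m is the increment of T(n,m) in
    its second argument.  Symmetry follows by induction ([half_sum_sym]).

    The recurrence for J ([besselJ_recurrence]) is a termwise comparison of
    power series.  It needs 1/Gamma(z) = z/Gamma(z+1), which is read off Euler's
    limit once that limit is known to exist for every complex z.

    The recurrence for Y.  For real t it passes from J to the quotient
    (J_t cos(t pi) - J_{-t})/sin(t pi).  At integer orders Y is a limit of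
    this quotient, so the point is that the limit exists.  Because of
    the recurrence, it is enough to treat the orders 0 and 1.  There the
    numerator vanishes, and the limit exists as soon as the order derivatives of
    J_{e} and J_{1+e} exist at e = 0.

    These derivatives, and the convergence of Euler's limit, come from one device,
    the predicate [jet r K f]: on |e| <= r the function f is affine in e up to an
    error O(e^2), with total size at most K.  The size is submultiplicative, so
    the predicate passes to absolutely convergent series ([jet_series]) and
    infinite products ([jet_infinite_product]).  Euler's limit is an infinite product
    whose i-th factor is 1 + O(1/i^2) in this sense ([euler_factor_jet]), and J is a
    series of such functions ([besselJ_jet]). *)

Local Open Scope C_scope.

Local Notation Clocally l := (locally (T := C_UniformSpace) l).
Local Notation is_Cseries := (is_series (K := C_AbsRing) (V := C_NormedModule)).

(** * Limits and series of complex numbers *)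

Lemma Cmod_sub_swap (a b : C) : Cmod (a - b) = Cmod (b - a).
Proof. rewrite <- Cmod_opp. f_equal. ring. Qed.

(** [C_UniformSpace] carries the product topology of R * R; this gives its
    neighbourhoods in terms of the modulus. *)
Lemma filterlim_C_iff {T} {F : (T -> Prop) -> Prop} {FF : Filter F} (f : T -> C) (l : C) :
  filterlim f F (Clocally l) <->
  forall eps : posreal, F (fun t => (Cmod (f t - l) < eps)%R).
Proof. exact (@filterlim_locally_ball_norm C_AbsRing T C_NormedModule F FF f l). Qed.

Lemma filterlim_Cplus {T} {F : (T -> Prop) -> Prop} {FF : Filter F} (f g : T -> C) (l k : C) :
  filterlim f F (Clocally l) ->
  filterlim g F (Clocally k) ->
  filterlim (fun t => f t + g t) F (Clocally (l + k)).
Proof.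
rewrite !filterlim_C_iff. intros Hf Hg eps.
assert (0 < eps / 2)%R as He by (destruct eps; simpl; lra).
specialize (Hf (mkposreal _ He)). specialize (Hg (mkposreal _ He)). simpl in *.
generalize (filter_and _ _ Hf Hg). apply filter_imp. intros t [H1 H2].
replace (f t + g t - (l + k)) with ((f t - l) + (g t - k)) by ring.
eapply Rle_lt_trans; [apply Cmod_triangle|]. lra.
Qed.

Lemma filterlim_Cmult {T} {F : (T -> Prop) -> Prop} {FF : Filter F} (f g : T -> C) (l k : C) :
  filterlim f F (Clocally l) ->
  filterlim g F (Clocally k) ->
  filterlim (fun t => f t * g t) F (Clocally (l * k)).
Proof.
rewrite !filterlim_C_iff. intros Hf Hg eps.
pose proof (Cmod_ge_0 l) as Hl. pose proof (Cmod_ge_0 k) as Hk.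
set (A := (Cmod l + Cmod k + 1)%R). assert (0 < A)%R as HA by (unfold A; lra).
assert (0 < Rmin 1 (eps / A))%R as He.
{ apply Rmin_pos; [lra|]. apply Rdiv_lt_0_compat; [apply eps|exact HA]. }
specialize (Hf (mkposreal _ He)). specialize (Hg (mkposreal _ He)). simpl in *.
generalize (filter_and _ _ Hf Hg). apply filter_imp. intros t [H1 H2].
replace (f t * g t - l * k) with
  ((f t - l) * (g t - k) + (l * (g t - k) + (f t - l) * k)) by ring.
eapply Rle_lt_trans.
{ eapply Rle_trans; [apply Cmod_triangle|]. apply Rplus_le_compat_l, Cmod_triangle. }
rewrite !Cmod_mult.
set (d := Rmin 1 (eps / A)) in *.
pose proof (Rmin_l 1 (eps / A)) as D1. pose proof (Rmin_r 1 (eps / A)) as D2. fold d in D1, D2.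
set (p := Cmod (f t - l)) in *. set (q := Cmod (g t - k)) in *.
assert (0 <= p)%R by apply Cmod_ge_0. assert (0 <= q)%R by apply Cmod_ge_0.
assert (d * A <= eps)%R.
{ replace (pos eps) with (eps / A * A)%R by (field; lra). apply Rmult_le_compat_r; lra. }
unfold A in *.
apply Rlt_le_trans with (d * (Cmod l + Cmod k + 1))%R; [|assumption].
assert (p * q <= d * q)%R by (apply Rmult_le_compat_r; lra).
assert (d * q < d * 1)%R by (apply Rmult_lt_compat_l; lra).
assert (Cmod l * q <= Cmod l * d)%R by (apply Rmult_le_compat_l; lra).
assert (p * Cmod k <= d * Cmod k)%R by (apply Rmult_le_compat_r; lra).
lra.
Qed.

Lemma filterlim_RtoC {T} {F : (T -> Prop) -> Prop} {FF : Filter F} (f : T -> R) (l : R) :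
  filterlim f F (locally l) ->
  filterlim (fun t => RtoC (f t)) F (Clocally (RtoC l)).
Proof.
intros H. apply filterlim_C_iff. intros eps.
generalize (proj1 (filterlim_locally f l) H eps). apply filter_imp. intros t Ht.
rewrite <- RtoC_minus, Cmod_R. exact Ht.
Qed.

Lemma Clim_seq_unique (u : nat -> C) (l : C) :
  filterlim u eventually (Clocally l) -> Clim_seq u = l.
Proof.
apply (@iota_filterlim_locally C_AbsRing C_CompleteNormedModule). apply Proper_StrongProper.
apply eventually_filter.
Qed.

Lemma Cseries_unique (a : nat -> C) (l : C) :
  is_Cseries a l -> Cseries a = l.
Proof.
apply (@iota_filterlim_locally C_AbsRing C_CompleteNormedModule). apply Proper_StrongProper.
apply eventually_filter.
Qed.

Lemma sum_le_Series (d : nat -> R) n : (forall k, (0 <= d k)%R) -> ex_series d -> (sum_n d n <= Series d)%R.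
Proof.
intros Hd Hex. apply (is_lim_seq_incr_compare (sum_n d)).
- exact (Series_correct d Hex).
- intros k. rewrite sum_Sn. change plus with Rplus. specialize (Hd (S k)). lra.
Qed.

Lemma series_Cmod_le (u : nat -> C) (d : nat -> R) (l : C) :
  (forall k, (Cmod (u k) <= d k)%R) -> ex_series d ->
  is_Cseries u l -> (Cmod l <= Series d)%R.
Proof.
intros Hd Hex Hu. apply Rnot_lt_le. intros Hlt.
assert (forall k, (0 <= d k)%R) as Hd0.
{ intros k. apply Rle_trans with (2 := Hd k), Cmod_ge_0. }
assert (0 < Cmod l - Series d)%R as He by lra.
destruct (proj1 (filterlim_C_iff (F := eventually) _ _) Hu (mkposreal _ He)) as [N HN].
specialize (HN N (le_n N)). simpl in HN.
assert (Cmod (sum_n (G := C_NormedModule) u N) <= Series d)%R as Hs.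
{ apply Rle_trans with (2 := sum_le_Series d N Hd0 Hex).
  eapply Rle_trans; [exact (@norm_sum_n_m C_AbsRing C_NormedModule u 0 N)|].
  apply sum_n_m_le. exact Hd. }
pose proof (Cmod_triangle (l - sum_n (G := C_NormedModule) u N) (sum_n (G := C_NormedModule) u N)) as T.
replace (l - sum_n (G := C_NormedModule) u N + sum_n (G := C_NormedModule) u N) with l in T by ring.
rewrite Cmod_sub_swap in T.
change (sum_n (G := C_AbelianMonoid) u N) with (sum_n (G := C_NormedModule) u N) in *. lra.
Qed.

Lemma ex_Cseries_le (u : nat -> C) (d : nat -> R) :
  (forall k, (Cmod (u k) <= d k)%R) -> ex_series d ->
  exists l, is_Cseries u l.
Proof.
intros Hd Hex. exact (@ex_series_le C_AbsRing C_CompleteNormedModule u d Hd Hex).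
Qed.

Lemma is_Cseries_plus (u v : nat -> C) (k l : C) :
  is_Cseries u k ->
  is_Cseries v l ->
  is_Cseries (fun i => u i + v i) (k + l).
Proof. exact (@is_series_plus C_AbsRing C_NormedModule u v k l). Qed.

Lemma is_Cseries_mult (c : C) (u : nat -> C) (l : C) :
  is_Cseries u l ->
  is_Cseries (fun i => c * u i) (c * l).
Proof. exact (@is_series_scal C_AbsRing C_NormedModule c u l). Qed.

(** * First-order expansions with uniform remainder *)

(** a + b e is the first-order Taylor expansion of f at 0, and K bounds the
    Taylor data weighted by powers of r.  With these weights K behaves as
    a Banach algebra norm, which is what makes infinite sums and products work.
    The variable e is real because the limits in the order of the Bessel
    functions are taken along the real direction. *)
Definition jet (r K : R) (f : R -> C) : Prop :=
  exists (a b : C) (M : R),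
    (0 <= M /\ Cmod a + Cmod b * r + M * r ^ 2 <= K)%R /\
    forall e : R, (Rabs e <= r)%R -> (Cmod (f e - (a + b * e)) <= M * e ^ 2)%R.

Definition has_jet (r : R) (f : R -> C) : Prop := exists K, jet r K f.

Lemma jet_weaken r K K' f : (K <= K')%R -> jet r K f -> jet r K' f.
Proof.
intros H (a & b & M & [HM HK] & Hf). exists a, b, M. repeat split; try assumption. lra.
Qed.

Lemma jet_ext r K f g :
  (forall e, (Rabs e <= r)%R -> f e = g e) -> jet r K f -> jet r K g.
Proof.
intros E (a & b & M & HM & Hf). exists a, b, M. split; [exact HM|].
intros e He. rewrite <- E by exact He. apply Hf, He.
Qed.

Lemma jet_bound r K f e : jet r K f -> (Rabs e <= r)%R -> (Cmod (f e) <= K)%R.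
Proof.
intros (a & b & M & [HM HK] & Hf) He.
replace (f e) with ((f e - (a + b * e)) + (a + b * e)) by ring.
eapply Rle_trans; [apply Cmod_triangle|].
eapply Rle_trans; [apply Rplus_le_compat_l, Cmod_triangle|].
rewrite Cmod_mult, Cmod_R. specialize (Hf e He).
assert (Cmod b * Rabs e <= Cmod b * r)%R by (apply Rmult_le_compat_l; [apply Cmod_ge_0|exact He]).
assert (e ^ 2 <= r ^ 2)%R.
{ rewrite <- (pow2_abs e). apply pow_incr. split; [apply Rabs_pos|exact He]. }
assert (M * e ^ 2 <= M * r ^ 2)%R by (apply Rmult_le_compat_l; assumption).
lra.
Qed.

Lemma jet_affine r (a b : C) : jet r (Cmod a + Cmod b * r) (fun e => a + b * e).
Proof.
exists a, b, 0%R. split; [split; lra|]. intros e _.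
replace (a + b * e - (a + b * e)) with (RtoC 0) by ring. rewrite Cmod_0. lra.
Qed.

Lemma jet_const r (a : C) : jet r (Cmod a) (fun _ => a).
Proof.
exists a, 0, 0%R. split; [rewrite Cmod_0; split; lra|]. intros e _.
replace (a - (a + 0 * e)) with (RtoC 0) by ring. rewrite Cmod_0. lra.
Qed.

Lemma jet_plus r K K' f g : (0 <= r)%R -> jet r K f -> jet r K' g -> jet r (K + K') (fun e => f e + g e).
Proof.
intros Hr (a & b & M & [HM HK] & Hf) (a' & b' & M' & [HM' HK'] & Hg).
exists (a + a'), (b + b'), (M + M')%R. split; [split|].
- lra.
- pose proof (Cmod_triangle a a'). pose proof (Cmod_triangle b b').
  assert (Cmod (b + b') * r <= (Cmod b + Cmod b') * r)%R by (apply Rmult_le_compat_r; lra). lra.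
- intros e He. specialize (Hf e He). specialize (Hg e He).
  replace (f e + g e - (a + a' + (b + b') * e)) with
    ((f e - (a + b * e)) + (g e - (a' + b' * e))) by ring.
  eapply Rle_trans; [apply Cmod_triangle|]. lra.
Qed.

(** The expansions multiply as polynomials in e, and every term of degree at least
    two is absorbed by the remainder.  The new size is bounded by the product
    (|a| + |b| r + M r^2) (|a'| + |b'| r + M' r^2). *)
Lemma jet_mult r K K' f g : (0 <= r)%R ->
  jet r K f -> jet r K' g -> jet r (K * K') (fun e => f e * g e).
Proof.
intros Hr (a & b & M & [HM HK] & Hf) (a' & b' & M' & [HM' HK'] & Hg).
pose proof (Cmod_ge_0 a) as A0. pose proof (Cmod_ge_0 b) as B0.
pose proof (Cmod_ge_0 a') as A0'. pose proof (Cmod_ge_0 b') as B0'.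
assert (0 <= Cmod b * r)%R as Br by (apply Rmult_le_pos; assumption).
assert (0 <= Cmod b' * r)%R as Br' by (apply Rmult_le_pos; assumption).
assert (0 <= r ^ 2)%R as R2 by apply pow2_ge_0.
exists (a * a'), (a * b' + b * a'),
  (Cmod b * Cmod b' + M * (Cmod a' + Cmod b' * r) + (Cmod a + Cmod b * r) * M' + M * M' * r ^ 2)%R.
split; [split|].
- repeat apply Rplus_le_le_0_compat; repeat apply Rmult_le_pos; lra.
- assert (Cmod (a * b' + b * a') <= Cmod a * Cmod b' + Cmod b * Cmod a')%R as T.
  { rewrite <- !Cmod_mult. apply Cmod_triangle. }
  rewrite Cmod_mult.
  apply Rle_trans with
    ((Cmod a + Cmod b * r + M * r ^ 2) * (Cmod a' + Cmod b' * r + M' * r ^ 2))%R.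
  + apply Rle_trans with (Cmod a * Cmod a' + (Cmod a * Cmod b' + Cmod b * Cmod a') * r +
      (Cmod b * Cmod b' + M * (Cmod a' + Cmod b' * r) + (Cmod a + Cmod b * r) * M' +
       M * M' * r ^ 2) * r ^ 2)%R; [|right; ring].
    apply Rplus_le_compat_r, Rplus_le_compat_l, Rmult_le_compat_r; assumption.
  + assert (0 <= M * r ^ 2)%R by (apply Rmult_le_pos; assumption).
    assert (0 <= M' * r ^ 2)%R by (apply Rmult_le_pos; assumption).
    apply Rmult_le_compat; lra.
- intros e He. specialize (Hf e He). specialize (Hg e He).
  set (p := f e - (a + b * e)) in *. set (q := g e - (a' + b' * e)) in *.
  replace (f e * g e - (a * a' + (a * b' + b * a') * e)) with
    (b * b' * (e * e) + p * (a' + b' * e) + (a + b * e) * q + p * q)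
    by (unfold p, q; ring).
  assert (forall u v : C, (Cmod (u + v * e) <= Cmod u + Cmod v * r)%R) as Haff.
  { intros u v. eapply Rle_trans; [apply Cmod_triangle|]. apply Rplus_le_compat_l.
    rewrite Cmod_mult, Cmod_R. apply Rmult_le_compat_l; [apply Cmod_ge_0|exact He]. }
  assert (0 <= e ^ 2)%R as E2 by apply pow2_ge_0.
  assert (e ^ 2 <= r ^ 2)%R as Er.
  { rewrite <- (pow2_abs e). apply pow_incr. split; [apply Rabs_pos|exact He]. }
  assert (Cmod (b * b' * (e * e)) = Cmod b * Cmod b' * e ^ 2)%R as S1.
  { rewrite !Cmod_mult, Cmod_R, <- Rabs_mult, Rabs_pos_eq; [ring|]. nra. }
  assert (Cmod (p * (a' + b' * e)) <= M * e ^ 2 * (Cmod a' + Cmod b' * r))%R as S2.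
  { rewrite Cmod_mult. apply Rmult_le_compat; auto using Cmod_ge_0. }
  assert (Cmod ((a + b * e) * q) <= (Cmod a + Cmod b * r) * (M' * e ^ 2))%R as S3.
  { rewrite Cmod_mult. apply Rmult_le_compat; auto using Cmod_ge_0. }
  assert (Cmod (p * q) <= M * r ^ 2 * (M' * e ^ 2))%R as S4.
  { rewrite Cmod_mult. apply Rmult_le_compat; auto using Cmod_ge_0.
    apply Rle_trans with (1 := Hf). apply Rmult_le_compat_l; assumption. }
  eapply Rle_trans; [apply Cmod_triangle|].
  eapply Rle_trans; [apply Rplus_le_compat_r, Cmod_triangle|].
  eapply Rle_trans; [apply Rplus_le_compat_r, Rplus_le_compat_r, Cmod_triangle|].
  rewrite S1.
  apply Rle_trans with (Cmod b * Cmod b' * e ^ 2 + M * e ^ 2 * (Cmod a' + Cmod b' * r) +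
    (Cmod a + Cmod b * r) * (M' * e ^ 2) + M * r ^ 2 * (M' * e ^ 2))%R; [lra|right; ring].
Qed.

Lemma jet_reflect r K f : jet r K f -> jet r K (fun e => f (- e)%R).
Proof.
intros (a & b & M & [HM HK] & Hf). exists a, (- b), M. rewrite Cmod_opp. repeat split; try assumption.
intros e He. replace (e ^ 2)%R with ((- e) ^ 2)%R by ring.
replace (a + - b * e) with (a + b * (- e)%R) by (rewrite RtoC_opp; ring).
apply Hf. now rewrite Rabs_Ropp.
Qed.

Lemma jet_nonneg r K f : (0 <= r)%R -> jet r K f -> (0 <= K)%R.
Proof.
intros Hr Hf. apply Rle_trans with (Cmod (f 0%R)); [apply Cmod_ge_0|].
apply (jet_bound r K f 0 Hf). now rewrite Rabs_R0.
Qed.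

(** Weierstrass M-test.  The coefficients and the remainders are summed separately;
    each of the three series is dominated by c, up to a power of r. *)
Lemma jet_series r (c : nat -> R) (f : nat -> R -> C) :
  (0 < r)%R -> (forall k, jet r (c k) (f k)) -> ex_series c ->
  has_jet r (fun e => Cseries (fun k => f k e)) /\
  forall e, (Rabs e <= r)%R ->
    is_Cseries (fun k => f k e) (Cseries (fun k => f k e)).
Proof.
intros Hr Hf Hc.
assert (forall e, (Rabs e <= r)%R -> is_Cseries
          (fun k => f k e) (Cseries (fun k => f k e))) as HF.
{ intros e He. destruct (ex_Cseries_le (fun k => f k e) c) as [l Hl]; [|exact Hc|].
  - intros k. exact (jet_bound r (c k) (f k) e (Hf k) He).
  - now rewrite (Cseries_unique _ _ Hl). }
split; [|exact HF].
(* The expansion data of all the terms are chosen simultaneously. *)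
assert (forall k, {p : C * C * R |
   (0 <= snd p /\ Cmod (fst (fst p)) + Cmod (snd (fst p)) * r + snd p * r ^ 2 <= c k)%R /\
    forall e : R, (Rabs e <= r)%R ->
     (Cmod (f k e - (fst (fst p) + snd (fst p) * e)) <= snd p * e ^ 2)%R}) as data.
{ intros k. apply constructive_indefinite_description.
  destruct (Hf k) as (a & b & M & H). exists (a, b, M). exact H. }
set (a := fun k => fst (fst (proj1_sig (data k)))).
set (b := fun k => snd (fst (proj1_sig (data k)))).
set (M := fun k => snd (proj1_sig (data k))).
assert (forall k, (0 <= M k /\ Cmod (a k) + Cmod (b k) * r + M k * r ^ 2 <= c k)%R) as HM.
{ intros k. exact (proj1 (proj2_sig (data k))). }
assert (forall k e, (Rabs e <= r)%R -> (Cmod (f k e - (a k + b k * e)) <= M k * e ^ 2)%R) as HR.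
{ intros k. exact (proj2 (proj2_sig (data k))). }
clearbody a b M. clear data.
assert (0 < r ^ 2)%R as Hr2 by (apply pow_lt; exact Hr).
assert (forall k, (0 <= Cmod (b k) * r)%R /\ (0 <= M k * r ^ 2)%R) as Hpos.
{ intros k. split; apply Rmult_le_pos; try apply Cmod_ge_0; try lra. apply HM. }
destruct (ex_Cseries_le a c) as [A HA]; [|exact Hc|].
{ intros k. specialize (HM k). specialize (Hpos k). lra. }
assert (ex_series (fun k => (c k * / r)%R)) as Hc1 by now apply ex_series_scal_r.
destruct (ex_Cseries_le b (fun k => (c k * / r)%R)) as [B HB]; [|exact Hc1|].
{ intros k. specialize (HM k). specialize (Hpos k). pose proof (Cmod_ge_0 (a k)).
  apply Rle_trans with (Cmod (b k) * r * / r)%R; [right; field; lra|].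
  apply Rmult_le_compat_r; [left; apply Rinv_0_lt_compat; exact Hr|lra]. }
assert (ex_series M) as HMs.
{ apply (@ex_series_le R_AbsRing R_CompleteNormedModule) with (fun k => (c k * / r ^ 2)%R).
  - intros k. change (norm (M k)) with (Rabs (M k)). rewrite Rabs_pos_eq by apply HM.
    specialize (HM k). specialize (Hpos k). pose proof (Cmod_ge_0 (a k)).
    apply Rle_trans with (M k * r ^ 2 * / r ^ 2)%R; [right; field; lra|].
    apply Rmult_le_compat_r; [left; apply Rinv_0_lt_compat; exact Hr2|lra].
  - now apply ex_series_scal_r. }
eexists. exists A, B, (Series M). split; [split|].
- rewrite <- (Rmult_0_l 0). apply Rle_trans with (sum_n M 0).
  + rewrite sum_O. rewrite Rmult_0_l. apply HM.
  + apply sum_le_Series; [apply HM|exact HMs].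
- apply Rle_refl.
- intros e He.
  replace (Series M * e ^ 2)%R with (Series (fun k => (M k * e ^ 2)%R)).
  2:{ apply Series_scal_r. }
  apply (series_Cmod_le (fun k => f k e + (-1) * (a k + e * b k))).
  + intros k. replace (f k e + -1 * (a k + e * b k)) with (f k e - (a k + b k * e)) by ring.
    apply HR, He.
  + now apply ex_series_scal_r.
  + replace (Cseries (fun k => f k e) - (A + B * e)) with
      (Cseries (fun k => f k e) + (-1) * (A + e * B)) by ring.
    apply is_Cseries_plus; [apply HF, He|].
    apply is_Cseries_mult, is_Cseries_plus; [exact HA|].
    apply is_Cseries_mult, HB.
Qed.

Lemma jet_slope r f : (0 < r)%R -> has_jet r f ->
  exists b : C, filterlim (fun e : R => (f e - f 0%R) / e) (locally' 0%R) (Clocally b).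
Proof.
intros Hr (K & a & b & M & [HM HK] & Hf). exists b.
assert (f 0%R = a) as E0.
{ assert (Cmod (f 0%R - (a + b * 0%R)) = 0%R) as Z.
  { apply Rle_antisym; [|apply Cmod_ge_0].
    eapply Rle_trans; [apply Hf; rewrite Rabs_R0; lra|]. right; ring. }
  apply Cmod_eq_0 in Z. replace (f 0%R) with (f 0%R - (a + b * 0%R) + a) by ring. rewrite Z. ring. }
apply filterlim_C_iff. intros eps.
assert (0 < Rmin r (eps / (M + 1)))%R as Hd.
{ apply Rmin_pos; [exact Hr|]. apply Rdiv_lt_0_compat; [apply eps|lra]. }
exists (mkposreal _ Hd). intros e He Hne.
change (Rabs (e - 0) < Rmin r (eps / (M + 1)))%R in He. rewrite Rminus_0_r in He.
pose proof (Rmin_l r (eps / (M + 1))) as D1. pose proof (Rmin_r r (eps / (M + 1))) as D2.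
assert (RtoC e <> 0) as Hec by (intros E; apply Hne; now injection E).
replace ((f e - f 0%R) / e - b) with ((f e - (a + b * e)) / e) by (rewrite E0; field; exact Hec).
rewrite Cmod_div by exact Hec. rewrite Cmod_R.
assert (0 < Rabs e)%R as Hae by (now apply Rabs_pos_lt).
apply Rmult_lt_reg_r with (Rabs e); [exact Hae|].
unfold Rdiv at 1. rewrite Rmult_assoc, Rinv_l, Rmult_1_r by lra.
eapply Rle_lt_trans; [apply Hf; lra|].
rewrite <- (pow2_abs e).
assert (Rabs e * (M + 1) < eps)%R.
{ replace (pos eps) with (eps / (M + 1) * (M + 1))%R by (field; lra).
  apply Rmult_lt_compat_r; lra. }
simpl. rewrite Rmult_1_r, <- Rmult_assoc. apply Rmult_lt_compat_r; [exact Hae|]. lra.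
Qed.

Fixpoint Cprod (u : nat -> C) (n : nat) : C :=
  match n with
  | O => 1
  | S p => Cprod u p * (1 + u p)
  end.

(** Turns an infinite product into a series, to which [jet_series] applies. *)
Lemma Cprod_telescope (u : nat -> C) n :
  Cprod u (S n) = 1 + sum_n (G := C_NormedModule) (fun i => Cprod u i * u i) n.
Proof.
induction n as [|n IH].
- rewrite sum_O. simpl. ring.
- rewrite sum_Sn. change plus with Cplus. simpl Cprod in IH |- *.
  transitivity (Cprod u n * (1 + u n) + (Cprod u n * (1 + u n)) * u (S n)); [ring|].
  rewrite IH at 1. ring.
Qed.

(** Submultiplicativity together with 1 + c <= exp c bounds all partial products
    by the same constant. *)
Lemma jet_Cprod r (c : nat -> R) (u : nat -> R -> C) n :
  (0 <= r)%R -> (forall k, jet r (c k) (u k)) -> ex_series c ->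
  jet r (exp (Series c)) (fun e => Cprod (fun k => u k e) n).
Proof.
intros Hr Hu Hc.
assert (forall k, (0 <= c k)%R) as Hc0 by (intros k; exact (jet_nonneg r (c k) (u k) Hr (Hu k))).
assert (jet r (exp (match n with O => 0 | S p => sum_n c p end)) (fun e => Cprod (fun k => u k e) n)) as H.
{ induction n as [|n IH].
  - apply (jet_weaken _ (Cmod 1)); [|apply jet_const]. rewrite exp_0, Cmod_1. lra.
  - apply (jet_weaken _ (exp (match n with O => 0 | S p => sum_n c p end) * (Cmod 1 + c n))).
    + apply Rle_trans with (exp (match n with O => 0 | S p => sum_n c p end) * exp (c n))%R.
      * apply Rmult_le_compat_l; [left; apply exp_pos|]. rewrite Cmod_1. apply exp_ineq1_le.
      * rewrite <- exp_plus. right. f_equal.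
        destruct n; [rewrite sum_O; ring|rewrite sum_Sn; reflexivity].
    + apply jet_mult; [exact Hr|exact IH|]. apply jet_plus; [exact Hr|apply jet_const|apply Hu]. }
revert H. apply jet_weaken.
assert (forall s, (s <= Series c)%R -> (exp s <= exp (Series c))%R) as Hexp.
{ intros s [Hs|Hs]; [left; now apply exp_increasing|right; now f_equal]. }
apply Hexp. destruct n as [|p].
- apply Rle_trans with (sum_n c 0); [rewrite sum_O; apply Hc0|]. now apply sum_le_Series.
- now apply sum_le_Series.
Qed.

Lemma jet_infinite_product r (c : nat -> R) (u : nat -> R -> C) :
  (0 < r)%R -> (forall k, jet r (c k) (u k)) -> ex_series c ->
  exists Q, has_jet r Q /\
  forall e, (Rabs e <= r)%R ->
    filterlim (fun n => Cprod (fun k => u k e) (S n)) eventually (Clocally (Q e)).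
Proof.
intros Hr Hu Hc.
assert (0 <= r)%R as Hr0 by lra.
destruct (jet_series r (fun k => (exp (Series c) * c k)%R)
  (fun k e => Cprod (fun k => u k e) k * u k e)) as [[K HK] HF].
- exact Hr.
- intros k. apply jet_mult; [exact Hr0| |apply Hu]. now apply jet_Cprod.
- exact (@ex_series_scal_l R_AbsRing R_NormedModule (exp (Series c)) c Hc).
- exists (fun e => 1 + Cseries (fun k => Cprod (fun k => u k e) k * u k e)). split.
  + eexists. apply jet_plus; [exact Hr0|apply jet_const|exact HK].
  + intros e He.
    apply filterlim_ext with (fun n => 1 + sum_n (G := C_NormedModule) (fun k => Cprod (fun k => u k e) k * u k e) n).
    { intros n. symmetry. apply Cprod_telescope. }
    apply filterlim_Cplus; [apply filterlim_const|]. exact (HF e He).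
Qed.

(** * Exponential, logarithm, sine and cosine *)

Lemma Cexp_plus (u v : C) : Cexp (u + v) = Cexp u * Cexp v.
Proof.
destruct u as [a b], v as [c d]. unfold Cexp, Cmult, Cplus, Re, Im; simpl.
rewrite exp_plus, cos_plus, sin_plus. f_equal; ring.
Qed.

Lemma Cexp_0 : Cexp 0 = 1.
Proof. unfold Cexp; simpl. rewrite exp_0, cos_0, sin_0. unfold RtoC. f_equal; ring. Qed.

Lemma Cexp_neq_0 (u : C) : Cexp u <> 0.
Proof.
intros E. assert (Cexp u * Cexp (- u) = 1) as H.
{ rewrite <- Cexp_plus, <- Cexp_0. f_equal. ring. }
rewrite E, Cmult_0_l in H. injection H. lra.
Qed.

Lemma Cexp_Clog (z : C) : z <> 0 -> Cexp (Clog z) = z.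
Proof.
intros Hz. pose proof (proj1 (Cmod_gt_0 z) Hz) as Hm.
destruct z as [a b]. unfold Cexp, Clog; simpl Re; simpl Im.
rewrite exp_ln by exact Hm.
set (m := Cmod (a, b)) in *.
assert (m ^ 2 = a ^ 2 + b ^ 2)%R as Em by (exact (Cmod2_alt (a, b))).
assert (-1 <= a / m <= 1)%R as Hb.
{ apply Rabs_le_between. unfold Rdiv. rewrite Rabs_mult, (Rabs_pos_eq (/ m)).
  - apply Rmult_le_reg_r with m; [exact Hm|]. rewrite Rmult_assoc, Rinv_l by lra.
    rewrite Rmult_1_r, Rmult_1_l. exact (re_le_Cmod (a, b)).
  - left. now apply Rinv_0_lt_compat. }
assert (sqrt (1 - (a / m)²) = Rabs b / m)%R as Es.
{ replace (1 - (a / m)²)%R with ((Rabs b / m) ^ 2)%R.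
  - apply sqrt_pow2. apply Rmult_le_pos; [apply Rabs_pos|left; now apply Rinv_0_lt_compat].
  - unfold Rsqr. replace ((Rabs b / m) ^ 2)%R with (Rabs b ^ 2 / m ^ 2)%R by (field; lra).
    rewrite pow2_abs. replace (b ^ 2)%R with (m ^ 2 - a ^ 2)%R by lra. field. lra. }
unfold Arg. simpl Re; simpl Im. fold m. destruct (Rle_dec 0 b) as [H|H].
- rewrite cos_acos, sin_acos, Es, Rabs_pos_eq by assumption. f_equal; field; lra.
- rewrite cos_neg, sin_neg, cos_acos, sin_acos, Es, Rabs_left by (assumption || lra).
  f_equal; field; lra.
Qed.

Lemma Cpower_plus (h u v : C) : Cpower h (u + v) = Cpower h u * Cpower h v.
Proof. unfold Cpower. rewrite <- Cexp_plus. f_equal. ring. Qed.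

Lemma Cpower_1 (h : C) : h <> 0 -> Cpower h 1 = h.
Proof. intros H. unfold Cpower. rewrite Cmult_1_l. now apply Cexp_Clog. Qed.

Lemma Ccos_RtoC (t : R) : Ccos t = cos t.
Proof.
unfold Ccos, Cdiv, Cexp, Ci, RtoC, Cmult, Copp, Cplus, Cinv, Re, Im; simpl.
replace (0 * t - 1 * 0)%R with 0%R by ring. replace (0 * 0 + 1 * t)%R with t by ring.
rewrite Ropp_0, exp_0, cos_neg, sin_neg. f_equal; field.
Qed.

Lemma Csin_RtoC (t : R) : Csin t = sin t.
Proof.
unfold Csin, Cdiv, Cminus, Cexp, Ci, RtoC, Cmult, Copp, Cplus, Cinv, Re, Im; simpl.
replace (0 * t - 1 * 0)%R with 0%R by ring. replace (0 * 0 + 1 * t)%R with t by ring.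
rewrite Ropp_0, exp_0, cos_neg, sin_neg. f_equal; field.
Qed.

Lemma MVT_from_0 (f f' : R -> R) (v : R) :
  (forall t, is_derive f t (f' t)) ->
  exists c, (Rabs c <= Rabs v)%R /\ (f v - f 0 = f' c * v)%R.
Proof.
intros Hf. destruct (MVT_gen f 0 v f') as (c & Hc & E).
- intros t _. apply Hf.
- intros t _. apply derivable_continuous_pt. exists (f' t). apply is_derive_Reals, Hf.
- exists c. split; [|rewrite E; ring].
  unfold Rmin, Rmax in Hc. destruct (Rle_dec 0 v).
  + rewrite !Rabs_pos_eq; lra.
  + rewrite !Rabs_left1; lra.
Qed.

Lemma Rabs_sin_le (v : R) : (Rabs (sin v) <= Rabs v)%R.
Proof.
destruct (MVT_from_0 sin cos v) as (c & _ & E).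
- intros t. apply is_derive_sin.
- rewrite sin_0, Rminus_0_r in E. rewrite E, Rabs_mult.
  rewrite <- (Rmult_1_l (Rabs v)) at 2. apply Rmult_le_compat_r; [apply Rabs_pos|].
  apply Rabs_le. pose proof (COS_bound c). lra.
Qed.

Lemma Rabs_cos_sub_1_le (v : R) : (Rabs (cos v - 1) <= Rabs v /\ Rabs (cos v - 1) <= v ^ 2)%R.
Proof.
replace (cos v - 1)%R with (- (2 * sin (v / 2) * sin (v / 2)))%R.
2:{ replace (cos v) with (cos (2 * (v / 2))) by (f_equal; field). rewrite cos_2a_sin. ring. }
rewrite Rabs_Ropp, !Rabs_mult, (Rabs_pos_eq 2) by lra.
pose proof (Rabs_sin_le (v / 2)) as H. pose proof (Rabs_pos (sin (v / 2))) as P.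
assert (Rabs (sin (v / 2)) <= 1)%R as B by (apply Rabs_le; pose proof (SIN_bound (v / 2)); lra).
unfold Rdiv in H at 2. rewrite Rabs_mult, (Rabs_pos_eq (/ 2)) in H by lra.
rewrite <- (pow2_abs v). pose proof (Rabs_pos v). split; nra.
Qed.

Lemma Rabs_sin_sub_le (v : R) : (Rabs (sin v - v) <= v ^ 2)%R.
Proof.
destruct (MVT_from_0 (fun t => sin t - t)%R (fun t => cos t - 1)%R v) as (c & Hc & E).
- intros t. auto_derive; [trivial|ring].
- rewrite sin_0, !Rminus_0_r in E. rewrite E, Rabs_mult, <- (pow2_abs v).
  simpl. rewrite Rmult_1_r. apply Rmult_le_compat_r; [apply Rabs_pos|].
  apply Rle_trans with (2 := Hc). apply Rabs_cos_sub_1_le.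
Qed.

Lemma exp_sub_affine_le (u : R) : (Rabs (exp u - 1 - u) <= u ^ 2 * exp (Rabs u))%R.
Proof.
pose proof (exp_ineq1_le u) as L. pose proof (exp_ineq1_le (- u)) as L'.
rewrite exp_Ropp in L'. pose proof (exp_pos u) as P.
assert (exp u - 1 <= u * exp u)%R as U.
{ apply Rmult_le_compat_r with (r := exp u) in L'; [|lra].
  rewrite Rinv_l in L' by lra. lra. }
rewrite Rabs_pos_eq by lra.
destruct (Rle_lt_dec 0 u) as [Hu|Hu].
- rewrite Rabs_pos_eq by exact Hu. nra.
- rewrite Rabs_left by exact Hu.
  assert (1 <= exp (- u))%R by (pose proof (exp_ineq1_le (- u)); lra). nra.
Qed.

Lemma Cmod_le_Rabs_sum (a b : R) : (Cmod (a, b) <= Rabs a + Rabs b)%R.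
Proof.
replace ((a, b) : C) with (a + b * Ci).
- eapply Rle_trans; [apply Cmod_triangle|]. rewrite Cmod_mult, Cmod_Ci, !Cmod_R. lra.
- unfold RtoC, Ci, Cplus, Cmult; simpl. f_equal; ring.
Qed.

(** With w = u + iv, the remainder splits as
    (e^u - 1 - u) cis v + (1 + u) (cis v - 1 - iv) + i u v,
    which reduces it to real one-variable estimates. *)
Lemma Cexp_sub_affine_le (w : C) :
  (Cmod (Cexp w - 1 - w) <= 4 * Cmod w ^ 2 * exp (Cmod w))%R.
Proof.
set (u := Re w). set (v := Im w). set (s := Cmod w).
assert (Rabs u <= s)%R as Hu by apply re_le_Cmod.
assert (Rabs v <= s)%R as Hv.
{ eapply Rle_trans; [|apply Rmax_Cmod]. apply Rmax_r. }
pose (cis := (cos v, sin v) : C).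
assert (Cmod cis = 1%R) as Hcis.
{ unfold Cmod, cis; simpl. rewrite !Rmult_1_r.
  pose proof (sin2_cos2 v) as E. unfold Rsqr in E.
  replace (cos v * cos v + sin v * sin v)%R with 1%R by lra. apply sqrt_1. }
replace (Cexp w - 1 - w) with
  (RtoC (exp u - 1 - u) * cis + (RtoC (1 + u) * (cis - 1 - Ci * v) + Ci * RtoC (u * v))).
2:{ unfold Cexp, cis. fold u. fold v.
    replace w with ((u, v) : C) by (unfold u, v, Re, Im; destruct w; reflexivity).
    apply injective_projections; simpl; ring. }
assert (Cmod (cis - 1 - Ci * v) <= 2 * v ^ 2)%R as H1.
{ replace (cis - 1 - Ci * v) with ((cos v - 1, sin v - v)%R : C).
  2:{ apply injective_projections; simpl; ring. }
  eapply Rle_trans; [apply Cmod_le_Rabs_sum|].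
  pose proof (proj2 (Rabs_cos_sub_1_le v)). pose proof (Rabs_sin_sub_le v). lra. }
pose proof (exp_sub_affine_le u) as H2.
assert (0 <= s)%R as Hs by apply Cmod_ge_0.
pose proof (exp_ineq1_le s) as H3.
assert (exp (Rabs u) <= exp s)%R as H4.
{ destruct Hu as [Hu|Hu]; [left; now apply exp_increasing|right; now f_equal]. }
assert (u ^ 2 <= s ^ 2)%R as Hu2.
{ rewrite <- (pow2_abs u). apply pow_incr. split; [apply Rabs_pos|exact Hu]. }
assert (v ^ 2 <= s ^ 2)%R as Hv2.
{ rewrite <- (pow2_abs v). apply pow_incr. split; [apply Rabs_pos|exact Hv]. }
eapply Rle_trans; [apply Cmod_triangle|].
eapply Rle_trans; [apply Rplus_le_compat_l, Cmod_triangle|].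
rewrite !Cmod_mult, Hcis, Cmod_Ci, !Cmod_R, Rmult_1_r, Rmult_1_l, Rabs_mult.
assert (Rabs (exp u - 1 - u) <= s ^ 2 * exp s)%R.
{ apply Rle_trans with (1 := H2). apply Rmult_le_compat; [apply pow2_ge_0|left; apply exp_pos|lra|lra]. }
assert (Rabs (1 + u) <= exp s)%R.
{ eapply Rle_trans; [apply Rabs_triang|]. rewrite Rabs_R1. lra. }
assert (Rabs (1 + u) * Cmod (cis - 1 - Ci * v) <= exp s * (2 * s ^ 2))%R.
{ apply Rmult_le_compat; [apply Rabs_pos|apply Cmod_ge_0|assumption|lra]. }
assert (Rabs u * Rabs v <= s * s)%R by (apply Rmult_le_compat; auto using Rabs_pos).
assert (s ^ 2 <= s ^ 2 * exp s)%R.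
{ rewrite <- (Rmult_1_r (s ^ 2)) at 1. apply Rmult_le_compat_l; [apply pow2_ge_0|lra]. }
simpl in *. lra.
Qed.

Lemma jet_Cexp_remainder r (w : C) : (0 <= r)%R ->
  jet r (4 * (Cmod w * r) ^ 2 * exp (Cmod w * r)) (fun e => Cexp (w * e) - 1 - w * e).
Proof.
intros Hr. exists 0, 0, (4 * Cmod w ^ 2 * exp (Cmod w * r))%R.
pose proof (exp_pos (Cmod w * r)) as P. pose proof (Cmod_ge_0 w) as W.
split; [split|].
- pose proof (pow2_ge_0 (Cmod w)). apply Rmult_le_pos; lra.
- rewrite Cmod_0. right. ring.
- intros e He. replace (Cexp (w * e) - 1 - w * e - (0 + 0 * e)) with (Cexp (w * e) - 1 - w * e) by ring.
  eapply Rle_trans; [apply Cexp_sub_affine_le|].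
  rewrite Cmod_mult, Cmod_R.
  assert (exp (Cmod w * Rabs e) <= exp (Cmod w * r))%R as E.
  { assert (Cmod w * Rabs e <= Cmod w * r)%R as [H|H] by (now apply Rmult_le_compat_l).
    - left. now apply exp_increasing.
    - right. now f_equal. }
  rewrite Rpow_mult_distr, pow2_abs.
  apply Rle_trans with (4 * (Cmod w ^ 2 * e ^ 2) * exp (Cmod w * r))%R; [|right; ring].
  apply Rmult_le_compat_l; [|exact E].
  pose proof (pow2_ge_0 (Cmod w)). pose proof (pow2_ge_0 e). nra.
Qed.

Lemma has_jet_Cexp r (w : C) : (0 <= r)%R -> has_jet r (fun e => Cexp (w * e)).
Proof.
intros Hr. eexists.
apply jet_ext with (fun e : R => (1 + w * e) + (Cexp (w * e) - 1 - w * e)).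
- intros e _. ring.
- apply jet_plus; [exact Hr|apply jet_affine|now apply jet_Cexp_remainder].
Qed.

(** The partial sums up to n stay below 2 - 1/(n+1). *)
Lemma ex_series_inv_square : ex_series (fun n => (/ (INR n + 1) ^ 2)%R).
Proof.
assert (forall n, 0 < INR n + 1)%R as P by (intros n; pose proof (pos_INR n); lra).
destruct (ex_finite_lim_seq_incr (sum_n (fun n => (/ (INR n + 1) ^ 2)%R)) 2) as [l Hl].
- intros n. rewrite sum_Sn. change plus with Rplus.
  assert (0 < / (INR (S n) + 1) ^ 2)%R by (apply Rinv_0_lt_compat, pow_lt, P). lra.
- intros n.
  assert (sum_n (fun n => (/ (INR n + 1) ^ 2)%R) n <= 2 - / (INR n + 1))%R as H.
  { induction n as [|n IH].
    - rewrite sum_O. simpl. right. field.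
    - rewrite sum_Sn. change plus with Rplus. rewrite S_INR.
      apply Rle_trans with (2 - / (INR n + 1) + / (INR n + 1 + 1) ^ 2)%R; [lra|].
      assert (/ (INR n + 1) - / (INR n + 1 + 1) - / (INR n + 1 + 1) ^ 2 =
              / ((INR n + 1) * (INR n + 1 + 1) ^ 2))%R as E.
      { specialize (P n). field. lra. }
      assert (0 < / ((INR n + 1) * (INR n + 1 + 1) ^ 2))%R.
      { specialize (P n). apply Rinv_0_lt_compat, Rmult_lt_0_compat; [exact P|apply pow_lt; lra]. }
      lra. }
  assert (0 < / (INR n + 1))%R by (apply Rinv_0_lt_compat, P). lra.
- exists l. exact Hl.
Qed.

(** * The reciprocal Gamma function as a limit of products *)

Lemma RtoC_neq_0 (t : R) : t <> 0%R -> RtoC t <> 0.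
Proof. intros H E. apply H. now injection E. Qed.

Lemma ln_le_sub_1 (t : R) : (0 < t)%R -> (ln t <= t - 1)%R.
Proof. intros H. pose proof (exp_ineq1_le (ln t)) as E. rewrite exp_ln in E by exact H. lra. Qed.

Lemma ln_step_bounds (a : R) : (0 < a)%R -> (/ (a + 1) <= ln (a + 1) - ln a <= / a)%R.
Proof.
intros Ha. split.
- pose proof (ln_le_sub_1 (a * / (a + 1))) as H.
  rewrite ln_mult, ln_Rinv in H by (try apply Rinv_0_lt_compat; lra).
  assert (0 < a * / (a + 1))%R as P by (apply Rmult_lt_0_compat; [|apply Rinv_0_lt_compat]; lra).
  specialize (H P). replace (a * / (a + 1) - 1)%R with (- / (a + 1))%R in H by (field; lra). lra.
- pose proof (ln_le_sub_1 ((a + 1) * / a)) as H.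
  rewrite ln_mult, ln_Rinv in H by (try apply Rinv_0_lt_compat; lra).
  assert (0 < (a + 1) * / a)%R as P by (apply Rmult_lt_0_compat; [|apply Rinv_0_lt_compat]; lra).
  specialize (H P). replace ((a + 1) * / a - 1)%R with (/ a)%R in H by (field; lra). lra.
Qed.

Lemma Clog_RtoC (t : R) : (0 < t)%R -> Clog t = ln t.
Proof.
intros Ht. unfold Clog. rewrite Cmod_R, Rabs_pos_eq by lra.
unfold Arg. simpl Im. simpl Re. destruct (Rle_dec 0 0) as [_|H]; [|lra].
rewrite Cmod_R, Rabs_pos_eq by lra. replace (t / t)%R with 1%R by (field; lra).
rewrite acos_1. reflexivity.
Qed.

Definition euler_term (z : C) (n : nat) : C :=
  Cpochhammer z (S n) / (INR (fact n) * Cpower (INR n) z).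

(** Increments of the logarithm: their sum over i < n is ln (n+1), so that they
    distribute the factor (n+1)^(-z) of Euler's limit over the factors of a product. *)
Definition euler_step (i : nat) : R := (ln (INR i + 1 + 1) - ln (INR i + 1))%R.

(** The i-th factor of the product for 1/Gamma(1+z), minus one.  The index is
    shifted so that i = 0 stands for the factor 1 + z/2: the factor
    1 + z carries no logarithm and is kept apart. *)
Definition euler_factor (z : C) (i : nat) : C :=
  (1 + z / (INR i + 1 + 1)%R) * Cexp (- z * euler_step i) - 1.

(** With x = c e/(i+2) and y = c e L, where L is the logarithm increment, the factor is
    (1 + x) exp(-y) - 1 = (x - y) - x y + (1 + x) (exp(-y) - 1 + y).
    Each of the three parts is O(1/i^2), the first because
    1/(i+2) <= L <= 1/(i+1). *)
Lemma euler_factor_jet (c : C) (r : R) : (0 <= r)%R ->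
  exists A, forall i, jet r (A * / (INR i + 1) ^ 2) (fun e => euler_factor (c * e) i).
Proof.
intros Hr. set (s := (Cmod c * r)%R).
assert (0 <= s)%R as Hs by (apply Rmult_le_pos; [apply Cmod_ge_0|exact Hr]).
exists (s + s * s + (1 + s) * (4 * s ^ 2 * exp s))%R. intros i.
set (a := (INR i + 1)%R). assert (1 <= a)%R as Ha by (unfold a; pose proof (pos_INR i); lra).
unfold euler_factor. fold a. unfold euler_step. fold a. set (L := (ln (a + 1) - ln a)%R).
destruct (ln_step_bounds a) as [L1 L2]; [lra|]. fold L in L1, L2.
set (y := (/ a)%R) in *. set (j := (/ (a + 1))%R) in *.
assert (0 < y)%R as Hy by (apply Rinv_0_lt_compat; lra).
assert (0 < j)%R as Hj by (apply Rinv_0_lt_compat; lra).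
assert (y <= 1)%R as Hy1 by (unfold y; rewrite <- Rinv_1; apply Rinv_le_contravar; lra).
assert (y - j <= y ^ 2)%R as Hyj.
{ replace (y - j)%R with (y * j)%R by (unfold y, j; field; lra). nra. }
pose proof (exp_pos s) as Es.
apply jet_ext with (fun e : R => (0 + c * (j - L)%R * e) +
   ((0 + c * j * e) * (0 + - c * L * e) +
    (1 + c * j * e) * (Cexp (- c * L * e) - 1 - (- c * L) * e))).
{ intros e _. unfold Cdiv. rewrite <- RtoC_inv by lra. fold j. rewrite RtoC_minus.
  replace (- (c * e) * L) with (- c * L * e) by ring. ring. }
assert (Cmod (c * j) * r = s * j)%R as N1.
{ rewrite Cmod_mult, Cmod_R, Rabs_pos_eq by lra. unfold s. ring. }
assert (Cmod (- c * L) * r = s * L)%R as N2.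
{ rewrite Cmod_mult, Cmod_opp, Cmod_R, Rabs_pos_eq by lra. unfold s. ring. }
assert (Cmod (c * (j - L)%R) * r = s * (L - j))%R as N3.
{ rewrite Cmod_mult, Cmod_R, Rabs_left1 by lra. unfold s. ring. }
eapply jet_weaken.
2:{ apply jet_plus; [exact Hr|apply jet_affine|apply jet_plus; [exact Hr| |]].
    - apply jet_mult; [exact Hr|apply jet_affine|apply jet_affine].
    - apply jet_mult; [exact Hr|apply jet_affine|now apply jet_Cexp_remainder]. }
rewrite N1, N2, N3, Cmod_0, Cmod_1.
replace (/ a ^ 2)%R with (y ^ 2)%R by (unfold y; field; lra).
assert (exp (s * L) <= exp s)%R as Ex.
{ assert (s * L <= s)%R as [H|H] by nra; [left; now apply exp_increasing|right; now f_equal]. }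
assert (s * (L - j) <= s * y ^ 2)%R by (apply Rmult_le_compat_l; lra).
assert ((s * j) * (s * L) <= (s * s) * y ^ 2)%R.
{ replace ((s * j) * (s * L))%R with ((s * s) * (j * L))%R by ring.
  apply Rmult_le_compat_l; nra. }
assert ((s * L) ^ 2 <= s ^ 2 * y ^ 2)%R.
{ rewrite <- Rpow_mult_distr. apply pow_incr. nra. }
assert ((1 + s * j) * (4 * (s * L) ^ 2 * exp (s * L)) <=
        (1 + s) * (4 * (s ^ 2 * y ^ 2) * exp s))%R.
{ pose proof (pow2_ge_0 (s * L)). pose proof (exp_pos (s * L)).
  apply Rmult_le_compat; [nra| |nra|].
  - apply Rmult_le_pos; lra.
  - apply Rmult_le_compat; lra. }
lra.
Qed.

Lemma Cpochhammer_euler (z : C) n :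
  Cpochhammer (1 + z) (S n) =
  (1 + z) * Cprod (euler_factor z) n * INR (fact (S n)) * Cexp (z * ln (INR n + 1)).
Proof.
induction n as [|n IH].
- simpl. rewrite Rplus_0_l, ln_1, Cmult_0_r, Cexp_0. ring.
- change (Cpochhammer (1 + z) (S (S n))) with (Cpochhammer (1 + z) (S n) * (1 + z + INR (S n))).
  rewrite IH. simpl Cprod. rewrite (fact_simpl (S n)), mult_INR, RtoC_mult.
  rewrite !S_INR.
  set (a := (INR n + 1)%R). assert (0 < a)%R as Ha by (unfold a; pose proof (pos_INR n); lra).
  change (euler_factor z n) with
    ((1 + z / (a + 1)%R) * Cexp (- z * (ln (a + 1) - ln a)%R) - 1).
  replace (z * ln (a + 1)) with (z * ln a + z * (ln (a + 1) - ln a)%R) by (rewrite RtoC_minus; ring).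
  rewrite Cexp_plus.
  replace (- z * (ln (a + 1) - ln a)%R) with (- (z * (ln (a + 1) - ln a)%R)) by ring.
  set (w := z * (ln (a + 1) - ln a)%R).
  assert (Cexp (- w) * Cexp w = 1) as E.
  { rewrite <- Cexp_plus. replace (- w + w) with (RtoC 0) by ring. apply Cexp_0. }
  assert (RtoC (a + 1) <> 0) as Ha1 by (apply RtoC_neq_0; lra).
  transitivity ((1 + z) * Cprod (euler_factor z) n * ((a + 1)%R * INR (fact (S n))) *
    (1 + z / (a + 1)%R) * (Cexp (z * ln a)) * (Cexp (- w) * Cexp w)); [|ring].
  rewrite E. rewrite RtoC_plus in Ha1 |- *. field. exact Ha1.
Qed.

(** The last factor on the right is (n+2+z)/(n+1): Euler's term has one more
    Pochhammer factor than the factorial has. *)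
Lemma euler_term_product (z : C) n :
  euler_term (1 + z) (S n) =
  (1 + z) * Cprod (euler_factor z) n * (1 + (1 + z) * (/ (INR n + 1))%R).
Proof.
unfold euler_term.
change (Cpochhammer (1 + z) (S (S n))) with (Cpochhammer (1 + z) (S n) * (1 + z + INR (S n))).
rewrite Cpochhammer_euler.
assert (0 < INR n + 1)%R as Ha by (pose proof (pos_INR n); lra).
unfold Cpower. rewrite S_INR, Clog_RtoC by exact Ha.
replace ((1 + z) * ln (INR n + 1)) with (RtoC (ln (INR n + 1)) + z * ln (INR n + 1)) by ring.
rewrite Cexp_plus. rewrite <- (Clog_RtoC (INR n + 1)), Cexp_Clog by (try apply RtoC_neq_0; lra).
rewrite (Clog_RtoC _ Ha), RtoC_inv by lra.
assert (RtoC (INR n + 1)%R <> 0) as Hn by (apply RtoC_neq_0; lra).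
pose proof (RtoC_neq_0 _ (INR_fact_neq_0 (S n))). pose proof (Cexp_neq_0 (z * ln (INR n + 1))).
field. auto.
Qed.

Lemma eventually_S (P : nat -> Prop) : eventually (fun n => P (S n)) -> eventually P.
Proof.
intros [N H]. exists (S N). intros [|n] Hn; [lia|]. apply H. lia.
Qed.

Lemma filterlim_shift (u : nat -> C) (l : C) :
  filterlim (fun n => u (S n)) eventually (Clocally l) ->
  filterlim u eventually (Clocally l).
Proof. intros H P HP. apply eventually_S, (H P HP). Qed.

Lemma filterlim_one_plus_inv (z : C) :
  filterlim (fun n => 1 + z * (/ (INR n + 1))%R) eventually (Clocally (RtoC 1)).
Proof.
replace (Clocally (RtoC 1)) with (Clocally (1 + z * 0)) by (f_equal; ring).
apply filterlim_Cplus; [apply filterlim_const|].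
apply filterlim_Cmult; [apply filterlim_const|].
apply filterlim_RtoC.
apply (filterlim_ext (fun n => / INR (S n))%R); [intros n; now rewrite S_INR|].
apply (is_lim_seq_incr_1 (fun n => / INR n)%R 0).
replace (Finite 0) with (Rbar_inv p_infty) by reflexivity.
apply is_lim_seq_inv; [apply is_lim_seq_INR|discriminate].
Qed.

(** The scale c serves two purposes: with c = 1 the variable e is the argument
    itself, and with c = z - 1 the point e = 1 is an arbitrary argument z. *)
Lemma euler_jet (c : C) (r : R) : (0 < r)%R ->
  has_jet r (fun e => Crgamma (1 + c * e)) /\
  forall e, (Rabs e <= r)%R ->
    filterlim (euler_term (1 + c * e)) eventually
      (Clocally (Crgamma (1 + c * e))).
Proof.
intros Hr. assert (0 <= r)%R as Hr0 by lra.
destruct (euler_factor_jet c r Hr0) as [A HA].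
destruct (jet_infinite_product r _ (fun i e => euler_factor (c * e) i) Hr HA) as (Q & [K HK] & HQ).
{ exact (@ex_series_scal_l R_AbsRing R_NormedModule A _ ex_series_inv_square). }
assert (forall e, (Rabs e <= r)%R -> filterlim (euler_term (1 + c * e)) eventually
      (Clocally ((1 + c * e) * Q e))) as H.
{ intros e He. apply filterlim_shift.
  apply (filterlim_ext (fun n => (1 + c * e) * Cprod (euler_factor (c * e)) n *
    (1 + (1 + c * e) * (/ (INR n + 1))%R))).
  { intros n. symmetry. apply euler_term_product. }
  replace ((1 + c * e) * Q e) with ((1 + c * e) * Q e * 1) by ring.
  apply filterlim_Cmult; [|apply filterlim_one_plus_inv].
  apply filterlim_Cmult; [apply filterlim_const|].
  apply filterlim_shift, HQ, He. }
assert (forall e, (Rabs e <= r)%R -> (1 + c * e) * Q e = Crgamma (1 + c * e)) as E.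
{ intros e He. symmetry. apply Clim_seq_unique, H, He. }
split.
- eexists. eapply jet_ext; [exact E|]. apply jet_mult; [exact Hr0|apply jet_affine|exact HK].
- intros e He. rewrite <- E by exact He. apply H, He.
Qed.

Lemma euler_limit (z : C) :
  filterlim (euler_term z) eventually (Clocally (Crgamma z)).
Proof.
destruct (euler_jet (z - 1) 1 Rlt_0_1) as [_ H].
specialize (H 1%R). rewrite Rabs_R1 in H. specialize (H (Rle_refl 1)).
replace (1 + (z - 1) * 1%R) with z in H by ring. exact H.
Qed.

Lemma Cpochhammer_shift (z : C) n : z * Cpochhammer (z + 1) n = Cpochhammer z n * (z + INR n).
Proof.
induction n as [|n IH]; [simpl; ring|].
simpl Cpochhammer. rewrite Cmult_assoc, IH, S_INR, RtoC_plus. ring.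
Qed.

(** The n-th Euler terms at z and z + 1 differ by the factor z n/(z + n + 1). *)
Lemma Crgamma_shift (z : C) : Crgamma z = z * Crgamma (z + 1).
Proof.
assert (filterlim (fun n => z * euler_term (z + 1) (S n)) eventually
          (Clocally (Crgamma z * 1))) as H.
{ apply (filterlim_ext (fun n => euler_term z (S n) * (1 + (z + 1) * (/ (INR n + 1))%R))).
  - intros n. unfold euler_term.
    assert (0 < INR n + 1)%R as Ha by (pose proof (pos_INR n); lra).
    assert (RtoC (INR n + 1)%R <> 0) as Hn by (apply RtoC_neq_0; lra).
    rewrite Cpower_plus, Cpower_1 by (now rewrite S_INR).
    pose proof (RtoC_neq_0 _ (INR_fact_neq_0 (S n))).
    pose proof (Cexp_neq_0 (z * Clog (INR (S n)))).
    assert (forall p q : C, z * (p / q) = z * p / q) as E by (intros; unfold Cdiv; ring).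
    rewrite E, Cpochhammer_shift, RtoC_inv by lra. unfold Cpower.
    rewrite !S_INR in *. rewrite !RtoC_plus in *. field. auto.
  - apply filterlim_Cmult; [|apply filterlim_one_plus_inv].
    intros P HP. destruct (euler_limit z P HP) as [N HN]. exists N. intros n Hn. apply HN. lia. }
rewrite Cmult_1_r in H.
apply (@filterlim_locally_unique nat C_AbsRing C_NormedModule eventually _ _ _ _ H).
apply filterlim_Cmult; [apply filterlim_const|].
intros P HP. destruct (euler_limit (z + 1) P HP) as [N HN]. exists N. intros n Hn. apply HN. lia.
Qed.

(** * Bessel functions of the first kind *)

(** By the functional equation the values cannot grow in modulus from z to z + 1
    when |z| >= 1, which holds for all but finitely many z = nu + k + 1. *)
Lemma Crgamma_bounded (nu : C) :
  exists M, forall k : nat, (Cmod (Crgamma (nu + INR k + 1)) <= M)%R.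
Proof.
destruct (nfloor_ex (Cmod nu + 1)) as [k0 [_ Hk0]].
{ pose proof (Cmod_ge_0 nu). lra. }
set (f := fun k => Cmod (Crgamma (nu + INR k + 1))).
assert (forall k, (f (S k0 + k)%nat <= f (S k0))%R) as Hdec.
{ induction k as [|k IH]; [rewrite Nat.add_0_r; apply Rle_refl|].
  apply Rle_trans with (2 := IH). unfold f.
  set (z := nu + INR (S k0 + k) + 1).
  replace (nu + INR (S k0 + S k) + 1) with (z + 1).
  2:{ unfold z. rewrite Nat.add_succ_r, S_INR, RtoC_plus. ring. }
  rewrite (Crgamma_shift z), Cmod_mult.
  rewrite <- (Rmult_1_l (Cmod (Crgamma (z + 1)))) at 1.
  apply Rmult_le_compat_r; [apply Cmod_ge_0|].
  pose proof (Cmod_triangle z (- nu)) as T. rewrite Cmod_opp in T.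
  replace (z + - nu) with (RtoC (INR (S k0 + k) + 1)) in T by (unfold z; rewrite RtoC_plus; ring).
  rewrite Cmod_R, plus_INR, S_INR in T. pose proof (pos_INR k0). pose proof (pos_INR k).
  rewrite Rabs_pos_eq in T by lra. lra. }
exists (sum_n f (S k0)). intros k. change (f k <= sum_n f (S k0))%R.
assert (forall i n, (i <= n)%nat -> (f i <= sum_n f n)%R) as Hsum.
{ assert (forall n, (0 <= sum_n f n)%R) as Hpos.
  { induction n as [|n IH]; [rewrite sum_O|rewrite sum_Sn; apply Rplus_le_le_0_compat; [exact IH|]];
    apply Cmod_ge_0. }
  intros i n Hi. induction Hi as [|n Hi IH].
  - destruct i as [|i]; [rewrite sum_O; apply Rle_refl|].
    rewrite sum_Sn. change plus with Rplus. specialize (Hpos i). lra.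
  - rewrite sum_Sn. change plus with Rplus. assert (0 <= f (S n))%R by apply Cmod_ge_0. lra. }
destruct (Nat.le_gt_cases k (S k0)) as [H|H]; [now apply Hsum|].
replace k with (S k0 + (k - S k0))%nat by lia.
apply Rle_trans with (1 := Hdec _). apply Hsum. lia.
Qed.

Definition bessel_term (nu h : C) (k : nat) : C :=
  (-1) ^ k * Crgamma (nu + INR k + 1) / INR (fact k) * h ^ (2 * k).

Lemma ex_series_exp (y : R) : ex_series (fun k => (y ^ k / INR (fact k))%R).
Proof.
exists (exp y). apply (is_series_ext (fun k => scal (pow_n y k) (/ INR (fact k))%R)).
- intros k. rewrite pow_n_pow. reflexivity.
- exact (is_exp_Reals y).
Qed.

Lemma Cmod_bessel_weight (h : C) k :
  Cmod ((-1) ^ k / INR (fact k) * h ^ (2 * k)) = ((Cmod h ^ 2) ^ k / INR (fact k))%R.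
Proof.
rewrite Cmod_mult, Cmod_div by apply RtoC_neq_0, INR_fact_neq_0.
rewrite !Cmod_pow, !Cmod_R, pow_mult.
replace (Rabs (-1)) with 1%R by (rewrite Rabs_left; lra). rewrite pow1.
rewrite Rabs_pos_eq by apply pos_INR. field. apply INR_fact_neq_0.
Qed.

Lemma bessel_term_split (nu h : C) k :
  bessel_term nu h k =
  (-1) ^ k / INR (fact k) * h ^ (2 * k) * Crgamma (nu + INR k + 1).
Proof. unfold bessel_term, Cdiv. ring. Qed.

Lemma bessel_series_converges (nu h : C) :
  is_Cseries
    (bessel_term nu h) (Cseries (bessel_term nu h)).
Proof.
destruct (Crgamma_bounded nu) as [M HM].
destruct (ex_Cseries_le (bessel_term nu h)
  (fun k => ((Cmod h ^ 2) ^ k / INR (fact k) * M)%R)) as [l Hl].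
- intros k. rewrite bessel_term_split, Cmod_mult, Cmod_bessel_weight.
  apply Rmult_le_compat_l; [|apply HM].
  rewrite <- Cmod_bessel_weight. apply Cmod_ge_0.
- apply ex_series_scal_r, ex_series_exp.
- now rewrite (Cseries_unique _ _ Hl).
Qed.

(** Comparison of the coefficients of h^(2k), with one index shift in the
    series of order nu + 1: they satisfy
    1/Gamma(nu+k) - k/Gamma(nu+k+1) = nu/Gamma(nu+k+1). *)
Lemma bessel_series_recurrence (nu h : C) :
  Cseries (bessel_term (nu - 1) h) + h * h * Cseries (bessel_term (nu + 1) h) =
  nu * Cseries (bessel_term nu h).
Proof.
(* The series of order nu + 1 multiplied by h^2, as a power series in h^2. *)
set (u := fun k => match k with O => RtoC 0 | S p => h * h * bessel_term (nu + 1) h p end).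
assert (is_Cseries u
          (h * h * Cseries (bessel_term (nu + 1) h))) as Hu.
{ apply is_series_decr_1.
  match goal with |- is_series _ ?l =>
    replace l with (h * h * Cseries (bessel_term (nu + 1) h)) end.
  - apply is_Cseries_mult, bessel_series_converges.
  - change plus with Cplus. change opp with Copp. simpl u. ring. }
pose proof (is_Cseries_plus _ _ _ _ (bessel_series_converges (nu - 1) h) Hu) as H1.
pose proof (is_Cseries_mult nu _ _ (bessel_series_converges nu h)) as H2.
rewrite <- (Cseries_unique _ _ H1).
apply Cseries_unique. eapply is_series_ext; [|exact H2].
intros k. match goal with |- _ = ?b => change (nu * bessel_term nu h k = b :> C) end.
rewrite !bessel_term_split.
pose proof (RtoC_neq_0 _ (INR_fact_neq_0 k)) as Hk.
rewrite (Crgamma_shift (nu - 1 + INR k + 1)).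
replace (nu - 1 + INR k + 1 + 1) with (nu + INR k + 1) by ring.
destruct k as [|k].
- simpl. ring.
- simpl u. rewrite bessel_term_split.
  replace (nu + 1 + INR k + 1) with (nu + INR (S k) + 1) by (rewrite S_INR, RtoC_plus; ring).
  set (g := Crgamma (nu + INR (S k) + 1)).
  rewrite fact_simpl, mult_INR, RtoC_mult in *.
  replace (2 * S k)%nat with (S (S (2 * k))) by lia. simpl Cpow.
  assert (RtoC (INR (S k)) <> 0) by (apply RtoC_neq_0, not_0_INR; lia).
  pose proof (RtoC_neq_0 _ (INR_fact_neq_0 k)).
  field. auto.
Qed.

Lemma half_neq_0 (x : C) : x <> 0 -> x / 2 <> 0.
Proof.
intros Hx H. apply Hx. replace x with (x / 2 * 2) by (field; apply RtoC_neq_0; lra).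
rewrite H. ring.
Qed.

Lemma besselJ_recurrence (nu x : C) : x <> 0 ->
  x / 2 * (besselJ (nu - 1) x + besselJ (nu + 1) x) = nu * besselJ nu x.
Proof.
intros Hx. apply half_neq_0 in Hx.
assert (forall a, besselJ a x = Cpower (x / 2) a * Cseries (bessel_term a (x / 2))) as E by reflexivity.
rewrite !E. set (h := x / 2) in *.
assert (h * Cpower h (nu - 1) = Cpower h nu) as E1.
{ rewrite <- (Cpower_1 h Hx) at 1. rewrite <- Cpower_plus. f_equal. ring. }
rewrite Cpower_plus, (Cpower_1 h Hx).
transitivity (h * Cpower h (nu - 1) * Cseries (bessel_term (nu - 1) h) +
  Cpower h nu * (h * h * Cseries (bessel_term (nu + 1) h))); [ring|].
rewrite E1.
transitivity (Cpower h nu * (Cseries (bessel_term (nu - 1) h) +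
  h * h * Cseries (bessel_term (nu + 1) h))); [ring|].
rewrite bessel_series_recurrence. ring.
Qed.

Lemma has_jet_mult r f g : (0 <= r)%R -> has_jet r f -> has_jet r g -> has_jet r (fun e => f e * g e).
Proof. intros Hr [K HK] [K' HK']. exists (K * K')%R. now apply jet_mult. Qed.

Lemma has_jet_plus r f g : (0 <= r)%R -> has_jet r f -> has_jet r g -> has_jet r (fun e => f e + g e).
Proof. intros Hr [K HK] [K' HK']. exists (K + K')%R. now apply jet_plus. Qed.

Lemma has_jet_const r a : has_jet r (fun _ => a).
Proof. eexists. apply jet_const. Qed.

Lemma has_jet_id r : has_jet r RtoC.
Proof. eexists. eapply jet_ext; [|apply (jet_affine r 0 1)]. intros e _. simpl. ring. Qed.

Lemma has_jet_reflect r f : has_jet r f -> has_jet r (fun e => f (- e)%R).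
Proof. intros [K HK]. exists K. now apply jet_reflect. Qed.

Lemma has_jet_ext r f g : (forall e, f e = g e) -> has_jet r f -> has_jet r g.
Proof. intros E [K HK]. exists K. eapply jet_ext; [|exact HK]. auto. Qed.

(** The radius 1/2 keeps j + e away from 0 for every j >= 1.  The remainder is
    e^2/(j^2 (j + e)). *)
Lemma jet_inv_shift (j : R) : (1 <= j)%R -> jet (/ 2) 2 (fun e => / (j + e)).
Proof.
intros Hj. exists (RtoC (/ j)), (RtoC (- / j ^ 2)), 2%R.
assert (0 < / j <= 1)%R as Hi.
{ split; [apply Rinv_0_lt_compat; lra|]. rewrite <- Rinv_1. apply Rinv_le_contravar; lra. }
split; [split; [lra|]|].
- rewrite !Cmod_R, Rabs_Ropp, <- pow_inv, !Rabs_pos_eq by (try apply pow2_ge_0; lra). nra.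
- intros e He. apply Rabs_le_between in He.
  replace (/ (j + e) - (RtoC (/ j) + RtoC (- / j ^ 2) * e)) with
    (RtoC ((/ j) ^ 2 * / (j + e) * e ^ 2)).
  2:{ rewrite <- RtoC_plus, <- RtoC_inv, <- RtoC_mult, <- RtoC_plus, <- RtoC_minus by lra.
      f_equal. field. lra. }
  rewrite Cmod_R.
  assert (0 < / (j + e) <= 2)%R as Hje.
  { split; [apply Rinv_0_lt_compat; lra|].
    replace 2%R with (/ / 2)%R by (apply Rinv_inv). apply Rinv_le_contravar; lra. }
  pose proof (pow2_ge_0 e).
  assert (0 <= (/ j) ^ 2 <= 1)%R as H1 by nra.
  assert (0 <= (/ j) ^ 2 * / (j + e) <= 2)%R as H2 by nra.
  rewrite Rabs_pos_eq by (apply Rmult_le_pos; lra).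
  apply Rmult_le_compat_r; lra.
Qed.

(** Going up by one divides by m + 1 + e and multiplies the size by at most 2.
    This growth is geometric, hence harmless against the factorials in the
    Bessel series. *)
Lemma Crgamma_jet :
  exists K, forall m : nat, jet (/ 2) (K * 2 ^ m) (fun e => Crgamma (INR m + e + 1)).
Proof.
destruct (euler_jet 1 (/ 2)) as [[K HK] _]; [lra|]. exists K. induction m as [|m IH].
- apply (jet_weaken _ K); [simpl; lra|]. eapply jet_ext; [|exact HK].
  intros e _. simpl. f_equal. ring.
- apply (jet_weaken _ (K * 2 ^ m * 2)); [simpl; lra|].
  eapply jet_ext; [|apply jet_mult; [lra|exact IH|apply (jet_inv_shift (INR m + 1))]].
  + intros e He. apply Rabs_le_between in He. cbv beta. rewrite (Crgamma_shift (INR m + e + 1)).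
    replace (INR m + e + 1 + 1) with (INR (S m) + e + 1) by (rewrite S_INR, RtoC_plus; ring).
    assert (INR m + e + 1 <> 0).
    { rewrite <- !RtoC_plus. apply RtoC_neq_0. pose proof (pos_INR m). lra. }
    rewrite RtoC_plus. replace (INR m + 1 + e) with (INR m + e + 1) by ring. field. assumption.
  + pose proof (pos_INR m). lra.
Qed.

Lemma besselJ_jet (n : nat) (x : C) : has_jet (/ 2) (fun e => besselJ (INR n + e) x).
Proof.
apply (has_jet_ext _ (fun e : R => Cpower (x / 2) (INR n) * Cexp (Clog (x / 2) * e) *
  Cseries (fun k => bessel_term (INR n + e) (x / 2) k))).
{ intros e. unfold besselJ. rewrite Cpower_plus. unfold Cpower at 3.
  rewrite (Cmult_comm e). reflexivity. }
apply has_jet_mult; [lra| |].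
{ apply has_jet_mult; [lra|apply has_jet_const|apply has_jet_Cexp; lra]. }
destruct Crgamma_jet as [K HK].
apply (jet_series (/ 2) (fun k => ((Cmod (x / 2) ^ 2) ^ k / INR (fact k) * (K * 2 ^ (n + k)))%R)).
- lra.
- intros k. eapply jet_ext.
  2:{ apply jet_mult; [lra| |exact (HK (n + k)%nat)].
      rewrite <- Cmod_bessel_weight. apply jet_const. }
  intros e _. simpl. rewrite bessel_term_split. do 2 f_equal.
  rewrite plus_INR, RtoC_plus. ring.
- apply (ex_series_ext (fun k => ((2 * Cmod (x / 2) ^ 2) ^ k / INR (fact k) * (K * 2 ^ n))%R)).
  + intros k. rewrite Rpow_mult_distr, pow_add. unfold Rdiv. simpl. ring.
  + apply ex_series_scal_r, ex_series_exp.
Qed.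

(** Holds at 0 too, where both sides are 0. *)
Lemma Cinv_RtoC (t : R) : / RtoC t = RtoC (/ t).
Proof.
destruct (Req_dec t 0) as [->|H]; [|now rewrite RtoC_inv].
rewrite Rinv_0. apply injective_projections; simpl; unfold Rdiv; ring.
Qed.

(** * Bessel functions of the second kind at integer orders *)

Lemma sin_quotient_limit :
  filterlim (fun e : R => RtoC e / Csin (e * PI)) (locally' 0%R)
    (Clocally (RtoC (/ PI))).
Proof.
apply (filterlim_ext (fun e => RtoC (/ (sin (e * PI) / e)))).
{ intros e. rewrite <- RtoC_mult, Csin_RtoC. unfold Cdiv. rewrite Cinv_RtoC, <- RtoC_mult.
  f_equal. unfold Rdiv. rewrite Rinv_mult, Rinv_inv. ring. }
apply filterlim_RtoC.
apply (is_lim_inv (fun e => sin (e * PI) / e)%R 0 PI).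
2:{ intros E. injection E. apply PI_neq0. }
assert (is_derive (fun e => sin (e * PI)) 0%R PI) as H.
{ auto_derive; [trivial|]. rewrite Rmult_0_l, cos_0. ring. }
apply is_derive_Reals in H. intros P [eps HP].
destruct (H eps (cond_pos eps)) as [d Hd]. exists d. intros e He Hne.
apply HP. change (Rabs (e - 0) < d)%R in He. rewrite Rminus_0_r in He.
specialize (Hd e Hne He). rewrite Rplus_0_l, Rmult_0_l, sin_0, Rminus_0_r in Hd. exact Hd.
Qed.

Lemma quotient_by_sin_limit (r : R) (g : R -> C) : (0 < r)%R -> has_jet r g -> g 0%R = 0 ->
  exists l, filterlim (fun e : R => g e / Csin (e * PI)) (locally' 0%R)
    (Clocally l).
Proof.
intros Hr Hg H0. destruct (jet_slope r g Hr Hg) as [b Hb].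
exists (b * RtoC (/ PI)).
eapply filterlim_within_ext; [|exact (filterlim_Cmult _ _ _ _ Hb sin_quotient_limit)].
- intros e He. simpl. rewrite H0. unfold Cdiv.
  assert (RtoC e <> 0) as Hec by now apply RtoC_neq_0.
  transitivity (g e * (/ e * e) * / Csin (e * PI)); [ring|].
  rewrite Cinv_l by exact Hec. ring.
Qed.

(** The limit runs over real orders, as [C_lim] does at a real point. *)
Definition order_limit (f : C -> C) (t : R) (l : C) : Prop :=
  filterlim (fun e : R => f (t + e)) (locally' 0%R) (Clocally l).

Lemma C_lim_unique (f : C -> C) (t : R) (l : C) : order_limit f t l -> C_lim f t = l.
Proof.
intros H.
assert (filterlim (fun s : R => f s) (locally' t) (Clocally l)) as H'.
{ intros P HP. destruct (H P HP) as [d Hd]. exists d. intros s Hs Hne.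
  replace (RtoC s) with (t + (s - t)%R) by (rewrite RtoC_minus; ring).
  apply Hd; [|lra]. change (Rabs (s - t - 0) < d)%R. rewrite Rminus_0_r. exact Hs. }
unfold C_lim. simpl. apply injective_projections; simpl.
- assert (is_lim (fun s => fst (f (RtoC s))) t (fst l)) as L.
  { apply (filterlim_comp _ _ _ (fun s : R => f s) fst _ (Clocally l)); [exact H'|].
    intros P [d Hd]. exists d. intros y Hy. apply Hd, Hy. }
  unfold RtoC in L. now rewrite (is_lim_unique _ _ _ L).
- assert (is_lim (fun s => snd (f (RtoC s))) t (snd l)) as L.
  { apply (filterlim_comp _ _ _ (fun s : R => f s) snd _ (Clocally l)); [exact H'|].
    intros P [d Hd]. exists d. intros y Hy. apply Hd, Hy. }
  unfold RtoC in L. now rewrite (is_lim_unique _ _ _ L).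
Qed.

Lemma Ccos_Csin_shift (t : R) :
  Ccos ((t + 1) * PI) = - Ccos (t * PI) /\ Csin ((t + 1) * PI) = - Csin (t * PI) /\
  Ccos ((t - 1) * PI) = - Ccos (t * PI) /\ Csin ((t - 1) * PI) = - Csin (t * PI).
Proof.
rewrite <- RtoC_plus, <- RtoC_minus, <- !RtoC_mult, !Ccos_RtoC, !Csin_RtoC, <- !RtoC_opp.
replace ((t + 1) * PI)%R with (t * PI + PI)%R by ring.
replace ((t - 1) * PI)%R with (t * PI - PI)%R by ring.
rewrite neg_cos, neg_sin, cos_minus, sin_minus, cos_PI, sin_PI.
repeat split; f_equal; ring.
Qed.

Lemma Cdiv_opp (a b : C) : a / - b = - a / b.
Proof.
assert (- b = 0 -> b = 0) as Hb by (intros E; replace b with (- - b) by ring; rewrite E; ring).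
destruct (Ceq_dec b 0) as [->|H].
- replace (- RtoC 0) with (RtoC 0) by ring. unfold Cdiv. rewrite Cinv_RtoC, Rinv_0. ring.
- field. auto.
Qed.

(** Shifting the order by one changes the sign of both cos(t pi) and sin(t pi), so
    the recurrences of J at t and at -t combine.  At integer t, where the divisor is 0,
    the identity reads 0 = 0. *)
Lemma besselY_quotient_recurrence (t : R) (x : C) : x <> 0 ->
  x / 2 * (besselY_quotient (t - 1) x + besselY_quotient (t + 1) x) =
  t * besselY_quotient t x.
Proof.
intros Hx. unfold besselY_quotient.
destruct (Ccos_Csin_shift t) as (E1 & E2 & E3 & E4). rewrite E1, E2, E3, E4, !Cdiv_opp.
pose proof (besselJ_recurrence t x Hx) as H1.
pose proof (besselJ_recurrence (- t) x Hx) as H2.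
replace (- (t - 1)) with (- t + 1) by ring. replace (- (t + 1)) with (- t - 1) by ring.
set (c := Ccos (t * PI)). unfold Cdiv at 2 3 4. set (s := / Csin (t * PI)).
transitivity ((c * (x / 2 * (besselJ (t - 1) x + besselJ (t + 1) x)) +
  x / 2 * (besselJ (- t - 1) x + besselJ (- t + 1) x)) * s); [ring|].
rewrite H1, H2. ring.
Qed.

Lemma has_jet_Ccos r : (0 <= r)%R -> has_jet r (fun e => Ccos (e * PI)).
Proof.
intros Hr. apply (has_jet_ext _ (fun e : R => / 2 * (Cexp (Ci * PI * e) + Cexp (- Ci * PI * e)))).
- intros e. unfold Ccos.
  replace (Ci * PI * e) with (Ci * (e * PI)) by ring.
  replace (- Ci * PI * e) with (- (Ci * (e * PI))) by ring. unfold Cdiv. ring.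
- apply has_jet_mult; [exact Hr|apply has_jet_const|].
  apply has_jet_plus; [exact Hr|now apply has_jet_Cexp|now apply has_jet_Cexp].
Qed.

(** The numerator J_e cos(e pi) - J_{-e} is differentiable and vanishes at e = 0. *)
Lemma besselY_quotient_limit_0 (x : C) :
  exists l, order_limit (fun mu => besselY_quotient mu x) 0 l.
Proof.
destruct (quotient_by_sin_limit (/ 2) (fun e => besselJ (INR 0 + e) x * Ccos (e * PI) +
  (-1) * besselJ (INR 0 + (- e)%R) x)) as [l Hl].
- lra.
- pose proof (besselJ_jet 0 x) as H. apply has_jet_plus; [lra| |].
  + apply has_jet_mult; [lra|exact H|apply has_jet_Ccos; lra].
  + apply has_jet_mult; [lra|apply has_jet_const|].
    exact (has_jet_reflect _ _ H).
- simpl. rewrite Ropp_0, Cmult_0_l, Ccos_RtoC, cos_0. ring.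
- exists l. revert Hl. apply filterlim_ext. intros e. unfold besselY_quotient. simpl INR.
  rewrite RtoC_opp, !Cplus_0_l. f_equal. ring.
Qed.

(** The order -1 - e in the numerator is outside the reach of [besselJ_jet]; the
    recurrence at -e expresses J_{-1-e} through J_{1-e} and J_{-e}.  The numerator
    becomes J_{1+e} cos(e pi) - J_{1-e} - (2/x) e J_{-e}, zero at e = 0. *)
Lemma besselY_quotient_limit_1 (x : C) : x <> 0 ->
  exists l, order_limit (fun mu => besselY_quotient mu x) 1 l.
Proof.
intros Hx.
destruct (quotient_by_sin_limit (/ 2) (fun e => besselJ (INR 1 + e) x * Ccos (e * PI) +
  ((-1) * besselJ (INR 1 + (- e)%R) x +
   (- / (x / 2)) * (RtoC e * besselJ (INR 0 + (- e)%R) x)))) as [l Hl].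
- lra.
- pose proof (besselJ_jet 0 x) as H0. pose proof (besselJ_jet 1 x) as H1.
  apply has_jet_plus; [lra| |apply has_jet_plus; [lra| |]].
  + apply has_jet_mult; [lra|exact H1|apply has_jet_Ccos; lra].
  + apply has_jet_mult; [lra|apply has_jet_const|exact (has_jet_reflect _ _ H1)].
  + apply has_jet_mult; [lra|apply has_jet_const|].
    apply has_jet_mult; [lra|apply has_jet_id|exact (has_jet_reflect _ _ H0)].
- simpl. rewrite Ropp_0, Cmult_0_l, Ccos_RtoC, cos_0. ring.
- exists l. revert Hl. apply filterlim_ext. intros e. unfold besselY_quotient. simpl INR.
  destruct (Ccos_Csin_shift e) as (E1 & E2 & _).
  replace (1 + e) with (e + 1) by ring. rewrite E1, E2, Cdiv_opp. f_equal.
  pose proof (besselJ_recurrence (- e) x Hx) as H. apply half_neq_0 in Hx.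
  rewrite RtoC_opp, Cplus_0_l.
  replace (1 + - e) with (- e + 1) by ring. replace (- (e + 1)) with (- e - 1) by ring.
  assert (- e * besselJ (- e) x * / (x / 2) = besselJ (- e - 1) x + besselJ (- e + 1) x) as E.
  { rewrite <- H. set (h := x / 2) in *.
    transitivity (h * / h * (besselJ (- e - 1) x + besselJ (- e + 1) x)); [ring|].
    rewrite Cinv_r by exact Hx. ring. }
  replace (- / (x / 2) * (e * besselJ (- e) x)) with (- e * besselJ (- e) x * / (x / 2)) by ring.
  rewrite E. ring.
Qed.

Section IntegerOrders.
Variable x : C.
Hypothesis Hx : x <> 0.

Lemma order_variable_limit (t : R) :
  filterlim (fun e : R => t + e) (locally' 0%R) (Clocally (RtoC t)).
Proof.
apply (filterlim_ext (fun e : R => RtoC (t + e))); [intros e; apply RtoC_plus|].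
apply filterlim_RtoC. intros P [d Hd]. exists d. intros e He _. apply Hd.
change (Rabs (e - 0) < d)%R in He. change (Rabs (t + e - t) < d)%R.
replace (t + e - t)%R with (e - 0)%R by ring. exact He.
Qed.

(** Solving the recurrence for one of its outer terms moves the limit to the
    next order, upwards (s = 1) or downwards (s = -1). *)
Lemma besselY_quotient_limit_step (t s : R) (k l : C) :
  (s = 1 \/ s = -1)%R ->
  order_limit (fun mu => besselY_quotient mu x) (t - s) k ->
  order_limit (fun mu => besselY_quotient mu x) t l ->
  order_limit (fun mu => besselY_quotient mu x) (t + s) (/ (x / 2) * (t * l) + (-1) * k).
Proof.
intros Hs Hk Hl. pose proof (half_neq_0 x Hx) as Hh.
apply (filterlim_ext (fun e : R => / (x / 2) * ((t + e) * besselY_quotient (t + e) x)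
   + (-1) * besselY_quotient ((t - s)%R + e) x)).
- intros e. pose proof (besselY_quotient_recurrence (t + e) x Hx) as H.
  rewrite RtoC_plus in H. rewrite <- H, Cmult_assoc, Cinv_l by exact Hh.
  destruct Hs as [-> | ->].
  + replace (RtoC (t - 1)%R + e) with (t + e - 1) by (rewrite RtoC_minus; ring).
    replace (RtoC (t + 1)%R + e) with (t + e + 1) by (rewrite RtoC_plus; ring). ring.
  + replace (RtoC (t - -1)%R + e) with (t + e + 1) by (rewrite RtoC_minus; ring).
    replace (RtoC (t + -1)%R + e) with (t + e - 1) by (rewrite RtoC_plus; ring). ring.
- apply filterlim_Cplus; apply filterlim_Cmult; try apply filterlim_const; [|exact Hk].
  apply filterlim_Cmult; [apply order_variable_limit|exact Hl].
Qed.

Lemma besselY_quotient_limit_integer (j : Z) :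
  exists l, order_limit (fun mu => besselY_quotient mu x) (IZR j) l.
Proof.
set (has := fun j => exists l, order_limit (fun mu => besselY_quotient mu x) (IZR j) l).
assert (forall i, has (i - 1)%Z -> has i -> has (i + 1)%Z) as up.
{ intros i [k Hk] [l Hl]. rewrite minus_IZR in Hk. eexists. rewrite plus_IZR.
  eapply besselY_quotient_limit_step; [now left|exact Hk|exact Hl]. }
assert (forall i, has (i + 1)%Z -> has i -> has (i - 1)%Z) as down.
{ intros i [k Hk] [l Hl]. replace (i - 1)%Z with (i + -1)%Z by lia.
  eexists. rewrite plus_IZR.
  eapply besselY_quotient_limit_step; [now right| |exact Hl].
  replace (IZR i - -1)%R with (IZR (i + 1)) by (rewrite plus_IZR; ring). exact Hk. }
assert (has 0%Z) as H0 by apply besselY_quotient_limit_0.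
assert (has 1%Z) as H1 by now apply besselY_quotient_limit_1.
assert (forall n, has (Z.of_nat n) /\ has (Z.of_nat (S n))) as Hup.
{ induction n as [|n [IH1 IH2]]; [now split|]. split; [exact IH2|].
  replace (Z.of_nat (S (S n))) with (Z.of_nat (S n) + 1)%Z by lia. apply up; [|exact IH2].
  replace (Z.of_nat (S n) - 1)%Z with (Z.of_nat n) by lia. exact IH1. }
assert (forall n, has (1 - Z.of_nat n)%Z /\ has (- Z.of_nat n)%Z) as Hdown.
{ induction n as [|n [IH1 IH2]]; [now split|].
  replace (1 - Z.of_nat (S n))%Z with (- Z.of_nat n)%Z by lia. split; [exact IH2|].
  replace (- Z.of_nat (S n))%Z with (- Z.of_nat n - 1)%Z by lia. apply down; [|exact IH2].
  replace (- Z.of_nat n + 1)%Z with (1 - Z.of_nat n)%Z by lia. exact IH1. }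
change (has j). destruct (Z.le_ge_cases 0 j) as [H|H].
- rewrite <- (Z2Nat.id j H). exact (proj1 (Hup _)).
- replace j with (- Z.of_nat (Z.to_nat (- j)))%Z by lia. exact (proj2 (Hdown _)).
Qed.

Lemma besselY_integer (j : Z) :
  order_limit (fun mu => besselY_quotient mu x) (IZR j) (besselY (IZR j) x).
Proof.
destruct (besselY_quotient_limit_integer j) as [l Hl].
replace (besselY (IZR j) x) with l; [exact Hl|].
unfold besselY. destruct (Ceq_dec (Csin (IZR j * PI)) 0) as [_|H].
- symmetry. exact (C_lim_unique _ _ _ Hl).
- exfalso. apply H. rewrite <- RtoC_mult, Csin_RtoC, (sin_eq_0_1 (IZR j * PI)) by (now exists j).
  reflexivity.
Qed.

Lemma besselY_recurrence (j : Z) :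
  x / 2 * (besselY (IZR (j - 1)) x + besselY (IZR (j + 1)) x) = IZR j * besselY (IZR j) x.
Proof.
assert (filterlim (fun e : R => x / 2 * (besselY_quotient (IZR (j - 1) + e) x +
   besselY_quotient (IZR (j + 1) + e) x)) (locally' 0%R) (Clocally
   (x / 2 * (besselY (IZR (j - 1)) x + besselY (IZR (j + 1)) x)))) as H1.
{ apply filterlim_Cmult; [apply filterlim_const|].
  apply filterlim_Cplus; apply besselY_integer. }
apply (@filterlim_locally_unique R C_AbsRing C_NormedModule (Rbar_locally' 0%R) _ _ _ _ H1).
apply (filterlim_ext (fun e : R => (IZR j + e) * besselY_quotient (IZR j + e) x)).
- intros e. rewrite <- RtoC_plus, <- besselY_quotient_recurrence by exact Hx.
  rewrite minus_IZR, plus_IZR, RtoC_plus, RtoC_minus, RtoC_plus.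
  do 2 f_equal; f_equal; ring.
- apply filterlim_Cmult; [apply order_variable_limit|apply besselY_integer].
Qed.
End IntegerOrders.

(** * Symmetry from the three-term recurrence *)

Definition weight (m n : nat) : R :=
  (INR (fact (m + n + 1)) /
   (INR (fact m) * INR (fact n) * INR (fact (m + 1)) * INR (fact (n + 1))))%R.

(** The expression of the theorem divided by (m+1)! (n+1)!, for an arbitrary
    sequence b of function values and h = x/2.  This normalization makes the
    coefficients symmetric. *)
Definition half_sum (b : Z -> C) (h : C) (m n : nat) : C :=
  (-1) ^ m *
  sum_n (fun k => weight m k * b (Z.of_nat k - Z.of_nat m - 1)%Z * h ^ (k + m)) n.

Lemma weight_sym m n : weight m n = weight n m.
Proof. unfold weight. rewrite (Nat.add_comm n m). f_equal. ring. Qed.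

(** The coefficient identity behind the recurrence step of [half_sum_column]: with
    W = w(m+1,n+1), the two terms on the left are (n+1)(n+2) W/(m+n+3) and
    (m+1)(m+2) W/(m+n+3). *)
Lemma weight_cross m n :
  (weight (S m) n - weight m (S n) = (INR n - INR m) * weight (S m) (S n))%R.
Proof.
unfold weight.
replace (S m + n + 1)%nat with (S (m + n + 1)) by lia.
replace (m + S n + 1)%nat with (S (m + n + 1)) by lia.
replace (S m + S n + 1)%nat with (S (S (m + n + 1))) by lia.
rewrite !Nat.add_1_r, !fact_simpl, !mult_INR, !S_INR, !plus_INR.
pose proof (INR_fact_neq_0 m). pose proof (INR_fact_neq_0 n).
pose proof (pos_INR m). pose proof (pos_INR n).
field. repeat split; try assumption; lra.
Qed.

Lemma weight_0_r m : weight m 0 = (/ INR (fact m))%R.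
Proof.
unfold weight. replace (m + 0 + 1)%nat with (m + 1)%nat by lia. simpl fact.
pose proof (INR_fact_neq_0 m). pose proof (INR_fact_neq_0 (m + 1)).
change (INR 1) with 1%R. field. tauto.
Qed.

Lemma Cmult_eq_reg_l (c a b : C) : c * a = c * b -> c <> 0 -> a = b.
Proof.
intros E Hc. rewrite <- (Cmult_1_l a), <- (Cinv_l c Hc), <- Cmult_assoc, E.
rewrite Cmult_assoc, (Cinv_l c Hc). ring.
Qed.

Section Symmetry.
Variables (b : Z -> C) (h : C).
Hypothesis Hh : h <> 0.
Hypothesis Hb : forall j, h * (b (j - 1)%Z + b (j + 1)%Z) = IZR j * b j.

(** The recurrence at 0 gives b(-1) = -b(1); the recurrences at n and -n then
    propagate the reflection formula from two consecutive indices to the next. *)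
Lemma recurrence_reflect_nat n :
  b (- Z.of_nat n)%Z = (-1) ^ n * b (Z.of_nat n) /\
  b (- Z.of_nat (S n))%Z = (-1) ^ (S n) * b (Z.of_nat (S n)).
Proof.
induction n as [|n [IH1 IH2]].
- split; [simpl; ring|].
  pose proof (Hb 0) as H. simpl in H |- *.
  assert (b (-1)%Z + b 1%Z = 0) as H'.
  { apply (Cmult_eq_reg_l h); [|exact Hh]. rewrite H. ring. }
  replace (b (-1)%Z) with (b (-1)%Z + b 1%Z - b 1%Z) by ring.
  rewrite H'. ring.
- split; [exact IH2|].
  pose proof (Hb (Z.of_nat (S n))) as H1.
  pose proof (Hb (- Z.of_nat (S n))) as H2.
  replace (Z.of_nat (S n) - 1)%Z with (Z.of_nat n) in H1 by lia.
  replace (Z.of_nat (S n) + 1)%Z with (Z.of_nat (S (S n))) in H1 by lia.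
  replace (- Z.of_nat (S n) - 1)%Z with (- Z.of_nat (S (S n)))%Z in H2 by lia.
  replace (- Z.of_nat (S n) + 1)%Z with (- Z.of_nat n)%Z in H2 by lia.
  rewrite opp_IZR, RtoC_opp in H2.
  rewrite IH1, IH2 in H2.
  apply (Cmult_eq_reg_l h); [|exact Hh].
  transitivity (- IZR (Z.of_nat (S n)) * ((-1) ^ S n * b (Z.of_nat (S n)))
                - h * ((-1) ^ n * b (Z.of_nat n))).
  { rewrite <- H2. ring. }
  transitivity ((-1) ^ n * (IZR (Z.of_nat (S n)) * b (Z.of_nat (S n)) - h * b (Z.of_nat n))).
  { simpl Cpow. ring. }
  rewrite <- H1. simpl Cpow. ring.
Qed.

Lemma neg1_pow_sqr n : (-1) ^ n * (-1) ^ n = 1.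
Proof.
rewrite <- Cpow_mult_l. replace (-1 * -1)%C with (RtoC 1) by ring. apply Cpow_1_l.
Qed.

Lemma recurrence_reflect m n :
  (-1) ^ n * b (Z.of_nat m - Z.of_nat n)%Z = (-1) ^ m * b (Z.of_nat n - Z.of_nat m)%Z.
Proof.
assert (forall p q, (-1) ^ (p + q) * b (- Z.of_nat q)%Z = (-1) ^ p * b (Z.of_nat q)) as E.
{ intros p q. rewrite (proj1 (recurrence_reflect_nat q)), Cpow_add_r.
  transitivity ((-1) ^ p * ((-1) ^ q * (-1) ^ q) * b (Z.of_nat q)); [ring|].
  rewrite neg1_pow_sqr. ring. }
destruct (Nat.le_ge_cases m n) as [H|H].
- replace (Z.of_nat m - Z.of_nat n)%Z with (- Z.of_nat (n - m))%Z by lia.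
  replace (Z.of_nat n - Z.of_nat m)%Z with (Z.of_nat (n - m)) by lia.
  rewrite <- E. do 2 f_equal. lia.
- replace (Z.of_nat n - Z.of_nat m)%Z with (- Z.of_nat (m - n))%Z by lia.
  replace (Z.of_nat m - Z.of_nat n)%Z with (Z.of_nat (m - n)) by lia.
  rewrite <- E. do 2 f_equal. lia.
Qed.

Lemma half_sum_row m n :
  half_sum b h m (S n) - half_sum b h m n =
  (-1) ^ m * (weight m (S n) * b (Z.of_nat n - Z.of_nat m)%Z * h ^ (S n + m)).
Proof.
unfold half_sum. rewrite sum_Sn. change plus with Cplus.
replace (Z.of_nat (S n) - Z.of_nat m - 1)%Z with (Z.of_nat n - Z.of_nat m)%Z by lia.
ring.
Qed.

(** Changing m alters every term of the sum, yet the difference collapses to one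
    term.  In the induction on n, the increments of both sums and the
    new right-hand side differ by h (b(n-m-1) + b(n-m+1)) - (n-m) b(n-m), up to a
    factor. *)
Lemma half_sum_column m n :
  half_sum b h (S m) n - half_sum b h m n =
  (-1) ^ m * (weight (S m) n * b (Z.of_nat n - Z.of_nat m)%Z * h ^ (S m + n)).
Proof.
induction n as [|n IH].
- unfold half_sum. rewrite !sum_O, !weight_0_r. rewrite !Nat.add_0_r, !Nat.add_0_l.
  pose proof (Hb (- Z.of_nat m - 1)) as H.
  replace (Z.of_nat 0 - Z.of_nat (S m) - 1)%Z with (- Z.of_nat m - 1 - 1)%Z by lia.
  replace (Z.of_nat 0 - Z.of_nat m - 1)%Z with (- Z.of_nat m - 1)%Z by lia.
  replace (Z.of_nat 0 - Z.of_nat m)%Z with (- Z.of_nat m - 1 + 1)%Z by lia.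
  set (b0 := b (- Z.of_nat m - 1)%Z) in *.
  set (b1 := b (- Z.of_nat m - 1 - 1)%Z) in *.
  set (b2 := b (- Z.of_nat m - 1 + 1)%Z) in *.
  assert (RtoC (/ INR (fact m))%R = (INR m + 1) * (/ INR (fact (S m)))%R) as E.
  { rewrite <- RtoC_plus, <- RtoC_mult. f_equal.
    rewrite fact_simpl, mult_INR, S_INR.
    pose proof (INR_fact_neq_0 m). pose proof (pos_INR m).
    field. split; [assumption|lra]. }
  rewrite E. set (c := RtoC (/ INR (fact (S m)))).
  rewrite minus_IZR, opp_IZR, <- INR_IZR_INZ, RtoC_minus, RtoC_opp in H.
  transitivity (- (-1) ^ m * c * h ^ m * (h * (b1 + b2) + (INR m + 1) * b0 - h * b2)).
  { simpl Cpow. ring. }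
  rewrite H. simpl Cpow. ring.
- pose proof (half_sum_row (S m) n) as H1. pose proof (half_sum_row m n) as H2.
  replace (half_sum b h (S m) (S n) - half_sum b h m (S n)) with
    ((half_sum b h (S m) (S n) - half_sum b h (S m) n) -
     (half_sum b h m (S n) - half_sum b h m n) +
     (half_sum b h (S m) n - half_sum b h m n)) by ring.
  rewrite H1, H2, IH.
  pose proof (Hb (Z.of_nat n - Z.of_nat m)) as H.
  replace (Z.of_nat n - Z.of_nat (S m))%Z with (Z.of_nat n - Z.of_nat m - 1)%Z by lia.
  replace (Z.of_nat (S n) - Z.of_nat m)%Z with (Z.of_nat n - Z.of_nat m + 1)%Z by lia.
  set (b0 := b (Z.of_nat n - Z.of_nat m)%Z) in *.
  set (b1 := b (Z.of_nat n - Z.of_nat m - 1)%Z) in *.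
  set (b2 := b (Z.of_nat n - Z.of_nat m + 1)%Z) in *.
  rewrite minus_IZR, <- !INR_IZR_INZ, RtoC_minus in H.
  pose proof (f_equal RtoC (weight_cross m n)) as W.
  rewrite RtoC_minus, RtoC_mult, RtoC_minus in W.
  replace (S n + S m)%nat with (S (S (m + n))) by lia.
  replace (S n + m)%nat with (S (m + n)) by lia.
  replace (S m + n)%nat with (S (m + n)) by lia.
  replace (S m + S n)%nat with (S (S (m + n))) by lia.
  simpl Cpow. set (H0 := h ^ (m + n)). set (s := (-1) ^ m).
  set (w := RtoC (weight (S m) (S n))) in *.
  transitivity (s * H0 * h * (w * (h * b2) - w * (h * (b1 + b2))
     + (RtoC (weight (S m) n) - RtoC (weight m (S n))) * b0)); [ring|].
  rewrite H, W. ring.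
Qed.

(** The left-hand increment is given by [half_sum_column], the right-hand one is
    the last term of the sum; reflection identifies them. *)
Lemma half_sum_step m n :
  half_sum b h (S m) n - half_sum b h m n = half_sum b h n (S m) - half_sum b h n m.
Proof.
rewrite half_sum_column, half_sum_row, (weight_sym n).
rewrite !Cmult_assoc, (Cmult_comm _ (RtoC (weight _ _))), <- !Cmult_assoc.
rewrite (Cmult_assoc _ (b _)), <- (recurrence_reflect m n). ring.
Qed.

Lemma half_sum_sym m n : half_sum b h m n = half_sum b h n m.
Proof.
assert (forall p q, half_sum b h p q = half_sum b h q p ->
                    half_sum b h (S p) q = half_sum b h q (S p)) as step.
{ intros p q E. pose proof (half_sum_step p q) as D. rewrite E in D.
  replace (half_sum b h (S p) q) with
    (half_sum b h (S p) q - half_sum b h q p + half_sum b h q p) by ring.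
  rewrite D. ring. }
revert n. induction m as [|m IH]; intros n; [|apply step, IH].
symmetry. induction n as [|n IHn]; [reflexivity|].
apply step, IHn.
Qed.
End Symmetry.

Lemma bessel_expr_half_sum B x m n :
  bessel_expr B m n x =
  INR (fact (m + 1)) * INR (fact (n + 1)) *
  half_sum (fun j => B (IZR j) x) (x / 2) m n.
Proof.
unfold bessel_expr, half_sum.
set (F := RtoC (INR (fact (m + 1)))).
transitivity ((-1) ^ m * INR (fact (n + 1)) * (F *
  sum_n (fun k => weight m k * B (IZR (Z.of_nat k - Z.of_nat m - 1)) x * (x / 2) ^ (k + m)) n)); [|ring].
f_equal.
pose proof (sum_n_mult_l (K := C_Ring) F
  (fun k => weight m k * B (IZR (Z.of_nat k - Z.of_nat m - 1)) x * (x / 2) ^ (k + m)) n) as E.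
etransitivity; [|exact E].
apply sum_n_ext. intros k. change mult with Cmult. unfold F.
rewrite !minus_IZR, <- !INR_IZR_INZ, !RtoC_minus.
rewrite !Cmult_assoc. do 2 f_equal.
rewrite <- RtoC_inv, <- !RtoC_mult by apply INR_fact_neq_0. f_equal.
unfold weight, Binomial.C.
replace (m + k + 1 - m)%nat with (k + 1)%nat by lia.
field. repeat split; apply INR_fact_neq_0.
Qed.

Lemma bessel_expr_sym_of_recurrence (B : C -> C -> C) (x : C) :
  x <> 0 ->
  (forall j : Z, x / 2 * (B (IZR (j - 1)) x + B (IZR (j + 1)) x) = IZR j * B (IZR j) x) ->
  forall m n, bessel_expr B m n x = bessel_expr B n m x.
Proof.
intros Hx HB m n.
rewrite !bessel_expr_half_sum, (half_sum_sym (fun j => B (IZR j) x)); [ring| |exact HB].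
now apply half_neq_0.
Qed.

Theorem theorem2 :
  forall (m n : nat), (0 < m)%nat -> (0 < n)%nat ->
  forall x : C, slit_plane x ->
    bessel_expr besselJ m n x = bessel_expr besselJ n m x /\
    bessel_expr besselY m n x = bessel_expr besselY n m x.
Proof.
intros m n _ _ x Hslit.
assert (x <> 0) as Hx.
{ intros E. apply Hslit. rewrite E. simpl. split; [reflexivity|lra]. }
split; apply bessel_expr_sym_of_recurrence; try exact Hx; intros j.
- rewrite minus_IZR, plus_IZR, RtoC_minus, RtoC_plus. now apply besselJ_recurrence.
- now apply besselY_recurrence.
Qed.
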